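(* Consider the stationary M/G/1 queue with arrival rate $\lambda>0$ and generic service time $B$ such that $\rho=\lambda EB<1$ and $E\exp(\gamma B)<\infty$ for some $\gamma>0$. The FB discipline minimises the decay rate of the sojourn time in the class of work-conserving disciplines: if $V_{\mathrm{FB}}$ denotes the sojourn time of a customer in the stationary queue under the FB discipline, and $V_{\pi}$ denotes the sojourn time of a customer in the stationary queue under a work-conserving discipline $\pi$ for which the decay rate $dr(V_\pi)$ exists, then $$dr(V_{\mathrm{FB}})\le dr(V_{\pi}).$$
   Context: M/G/1 queue: a single server working at unit rate, customers arriving according to a Poisson process with rate $\lambda>0$, i.i.d. service times distributed as a nonnegative random variable $B$ (not almost surely zero), independent of the arrival process. A service discipline is work-conserving if the server always works at full (unit) rate whenever there is work in the system, and no work is created or lost. FB (Foreground-Background) discipline: at every moment the server serves those customers present that have received the least amount of service so far; if there are $n$ such customers, each of them is served at rate $1/n$. The sojourn time is the time between arrival and departure of a customer who arrives at the queue in its stationary regime. The (asymptotic) decay rate of a random variable $X$ is $dr(X)=\big|\lim_{x\to\infty}x^{-1}\log P(X>x)\big|$, given that the limit exists. *)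

(* Defs.v *)
From HB Require Import structures.
From mathcomp Require Import all_boot all_order all_algebra finmap.
From mathcomp Require Import all_classical all_reals all_analysis.

Set Implicit Arguments.
Unset Strict Implicit.
Unset Printing Implicit Defensive.

Import Order.TTheory GRing.Theory Num.Theory numFieldNormedType.Exports.

Local Open Scope classical_set_scope.
Local Open Scope ring_scope.

Section decay_rate.
Context d (T : measurableType d) (R : realType) (P : probability T R).
Local Open Scope ereal_scope.

(* x^-1 log P(X > x); it is -oo when P(X > x) = 0, so that limits and decay
   rates are taken in the extended reals. *)
Definition log_tail (X : {RV P >-> R}) (x : R) : \bar R :=
  (x^-1)%:E * lne (ccdf X x).

Definition has_decay_rate (X : {RV P >-> R}) : Prop :=
  cvg (log_tail X x @[x --> +oo%R]).

Definition decay_rate (X : {RV P >-> R}) : \bar R :=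
  `| lim (log_tail X x @[x --> +oo%R]) |.

End decay_rate.

(* One sample path of a queue. Customers are indexed by int in order of
   arrival; T n, B n and V n are the arrival time, the service time and the
   sojourn time of customer n, and r n t is the rate at which customer n is
   served at time t. *)
Section sample_path.
Context (R : realType) (T B V : int -> R) (r : int -> R -> R).

Definition present (t : R) : set int := [set n | T n <= t < T n + V n].

Definition attained (n : int) (t : R) : R :=
  \int[lebesgue_measure]_(s in `[T n, t]) r n s.

Definition has_work (t : R) : Prop :=
  exists2 n, present t n & attained n t < B n.

Definition total_rate (t : R) : \bar R :=
  (\esum_(n in [set: int]) (r n t)%:E)%E.

(* A customer with positive service time leaves exactly when its service is
   completed. A customer with service time 0 may be kept waiting by the
   discipline (FIFO does so, whereas FB lets it leave at once), but
   [path_waiting] does not let it stay when there is no work. *)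
Record service_path : Prop := ServicePath {
  path_measurable : forall n, measurable_fun setT (r n);
  path_rate_ge0 : forall n t, 0 <= r n t;
  path_rate_absent : forall n t, ~ present t n -> r n t = 0;
  path_unit_rate : forall t, (total_rate t <= 1)%E;
  path_sojourn_ge0 : forall n, 0 <= V n;
  path_finite : forall t, finite_set (present t);
  path_served : forall n, attained n (T n + V n) = B n;
  path_unserved :
    forall n t, 0 < B n -> present t n -> attained n t < B n;
  path_waiting : forall t, present t !=set0 -> has_work t
}.

Definition work_conserving_path : Prop :=
  forall t, has_work t -> total_rate t = 1%E.

Definition least_attained (t : R) : set int :=
  [set n | present t n /\
           forall m, present t m -> attained n t <= attained m t].

Definition fb_path : Prop :=
  forall n t,
    r n t = \1_(least_attained t) n / #|` fset_set (least_attained t)|%:R.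

End sample_path.

Section mg1.
Context d (Om : measurableType d) (R : realType) (P : probability Om R).

(* [interarrival Q n] is the time between the arrivals of n and n + 1. *)
Record queue := Queue {
  interarrival : int -> {RV P >-> R};
  service : int -> {RV P >-> R};
  sojourn : int -> {RV P >-> R};
  service_rate : Om -> int -> R -> R
}.

Variable Q : queue.

(* Customer 0 arrives at time 0. With i.i.d. exponential interarrival times on
   both sides of 0, this is the stationary Poisson arrival process with an
   arrival added at 0, i.e. as seen by a typical arriving customer, and
   [sojourn Q 0] is the sojourn time of that customer. *)
Definition arrival (n : int) (w : Om) : R :=
  match n with
  | Posz m => \sum_(i < m) interarrival Q (Posz i) w
  | Negz m => - \sum_(i < m.+1) interarrival Q (Negz i) w
  end.

Definition mutually_independent (I : choiceType) (X : I -> {RV P >-> R}) :=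
  forall (J : {fset I}) (A : I -> set R), (forall i, measurable (A i)) ->
    P (\bigcap_(i in [set` J]) (X i @^-1` A i)) =
    (\prod_(i <- J) P (X i @^-1` A i))%E.

Definition queue_input (i : int + int) : {RV P >-> R} :=
  match i with
  | inl n => interarrival Q n
  | inr n => service Q n
  end.

Definition mg1_input (lambda : R) (mu : set R -> \bar R) : Prop :=
  [/\ mutually_independent queue_input,
      forall n (A : set R), measurable A ->
        distribution P (interarrival Q n) A = exponential_prob lambda A &
      forall n (A : set R), measurable A ->
        distribution P (service Q n) A = mu A].

(* Invariance under shifts of the customer index. Arrival epochs and sojourn
   times determine who is in the system at any time. *)
Definition stationary : Prop :=
  forall (k : int) (J : {fset int}) (A : int -> set (R * R * R)),
    (forall n, measurable (A n)) ->
    let X n w := (interarrival Q n w, service Q n w, sojourn Q n w) in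
    P (\bigcap_(n in [set` J]) (X (n + k) @^-1` A n)) =
    P (\bigcap_(n in [set` J]) (X n @^-1` A n)).

Definition valid : Prop :=
  {ae P, forall w,
    service_path (arrival^~ w) (service Q ^~ w) (sojourn Q ^~ w)
      (service_rate Q w)}.

Definition stationary_mg1 (lambda : R) (mu : set R -> \bar R) : Prop :=
  [/\ mg1_input lambda mu, valid & stationary].

Definition work_conserving : Prop :=
  {ae P, forall w,
    work_conserving_path (arrival^~ w) (service Q ^~ w) (sojourn Q ^~ w)
      (service_rate Q w)}.

Definition foreground_background : Prop :=
  {ae P, forall w,
    fb_path (arrival^~ w) (sojourn Q ^~ w) (service_rate Q w)}.

End mg1.

(* Main.v *)
Require Import Defs.
From HB Require Import structures.
From mathcomp Require Import all_boot all_order all_algebra finmap.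
From mathcomp Require Import all_classical all_reals all_analysis.
From mathcomp Require Import measurable_realfun.
From mathcomp Require Import zify ring lra.
Set Implicit Arguments.
Unset Strict Implicit.
Unset Printing Implicit Defensive.
Import Order.TTheory GRing.Theory Num.Theory numFieldNormedType.Exports.
Local Open Scope classical_set_scope.
Local Open Scope ring_scope.

(* Upper bound, for every work-conserving discipline: if the sojourn time exceeds
   x, some customer - n found the server free of older customers and the work of
   the customers - n, ..., M, where M is the last arrival before x, is at least
   x - T (- n). With m = E exp (theta B), Chernoff bounds for these events sum to
   P (V > x) <= C exp (- (theta - s) x) as soon as s > lambda (m - 1).

   Lower bound, for FB: a customer with service time at least b leaves only after
   every customer j it meets has received min (B j, b), so its sojourn time
   is at least a busy period, started with work b, of the queue with
   service times min (B, b). If z = theta + i omega makes the Laplace exponent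
   kappa (z) = z - lambda (E exp (z min (B, b)) - 1) real, then
   exp (theta u) sin (omega u), cut off to ]0, pi / omega[, is a subsolution for
   the workload killed at 0, whence P (V > x) >= c exp (- kappa (z) x).

   If theta is the infimum of the exponents for which such a z exists (possibly
   with smaller b and larger omega), then E exp (theta B) is finite and, as b
   exhausts the support of B and omega tends to 0, kappa (z) comes arbitrarily
   close to theta - lambda (E exp (theta B) - 1). So the two bounds agree: this is
   the decay rate of FB, and it bounds every other one from below. *)

(** * Independence *)

(** The common exponent is the maximum over theta of the concave function theta - lambda (E exp
    (theta B) - 1). At an interior maximum lambda E (B exp (theta B)) = 1, but E exp (theta B) may
    become infinite at an abscissa where the derivative has not reached 0, and then the maximiser
    sits on the boundary. Truncation at b removes this case distinction: the transform of c = min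
    (B, b) is entire, and lambda E (exp (theta c) sin (omega c)) = omega, which makes the Laplace
    exponent real, is a version of the derivative condition that can be solved for every b charged
    by the law of B. A real exponential would not survive the killing at 0, since it does not vanish
    there. The sine does vanish at 0, where the workload arrives continuously, and it is negative
    just above pi / omega, so cutting it off there only helps; the bounded support also controls the
    remainder after many arrivals. For the upper bound the obstacle is the infinite past, as the
    busy period of customer 0 has no a priori beginning. Finiteness of the set of present customers,
    transported by stationarity, confines the customers that matter to finitely many up to small
    probability. *)

Section independence.
Context d (Om : measurableType d) (R : realType) (P : probability Om R).
Context (I : choiceType) (X : I -> {RV P >-> R}).
Implicit Type C : set I.

Definition cylinder C : set (set Om) :=
  [set E | exists J : {fset I}, exists A : I -> set R,
    [/\ forall i, measurable (A i), [set` J] `<=` C &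
        E = \bigcap_(i in [set` J]) (X i @^-1` A i)]].

Lemma cylinderI C : setI_closed (cylinder C).
Proof.
move=> E F [J [A [mA JC ->]]] [K [B [mB KC ->]]].
exists (J `|` K)%fset.
exists (fun i => (if i \in J then A i else setT) `&`
                 (if i \in K then B i else setT)).
split.
- by move=> i; apply: measurableI; case: ifP.
- by move=> i /=; rewrite inE => /orP[/JC|/KC].
- apply/seteqP; split => w /=.
    move=> [AJ BK] i /= _; split; case: ifP => // iH; [exact: AJ|exact: BK].
  move=> H; split => i /= iH.
    by have /= := H i; rewrite inE iH => /(_ isT)[].
  by have /= := H i; rewrite inE iH orbT => /(_ isT)[].
Qed.

Lemma measurable_cylinder C : cylinder C `<=` measurable.
Proof.
move=> E [J [A [mA _ ->]]]; apply: fin_bigcap_measurable => // i _.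
by rewrite -[_ @^-1` _]setTI; exact: measurable_funPT.
Qed.

Lemma measurable_sigma_cylinder C : <<s cylinder C >> `<=` measurable.
Proof.
apply: smallest_sub => //; last exact: measurable_cylinder.
exact: sigma_algebra_measurable.
Qed.

Lemma measurable_fun_sigma_cylinder C d' (S : measurableType d')
  (Y : Om -> S) :
  measurable_fun setT (Y : g_sigma_algebraType (cylinder C) -> S) ->
  measurable_fun setT Y.
Proof.
move=> mY _ A mA; apply: (@measurable_sigma_cylinder C).
exact: (mY measurableT A mA).
Qed.

Lemma measurable_coordinate C i : C i ->
  measurable_fun setT (X i : g_sigma_algebraType (cylinder C) -> R).
Proof.
move=> Ci _ A mA; rewrite setTI; apply: sub_sigma_algebra.
exists [fset i]%fset, (fun=> A); split => //.
- by move=> j /=; rewrite inE => /eqP ->.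
- apply/seteqP; split => w /=; first by move=> wA j /= /[!inE] /eqP ->.
  by move=> /(_ i); apply; rewrite /= ?inE ?eqxx.
Qed.

Hypothesis indepX : mutually_independent X.

(** For fixed D both sides are finite measures in E, the restriction of P to the event on X j and a
    multiple of P. They agree on the pi-system of cylinders, hence on the sigma-algebra it
    generates. *)
Lemma cylinder_indep C j D E : ~ C j -> measurable D -> <<s cylinder C >> E ->
  (P (E `&` X j @^-1` D) = P E * P (X j @^-1` D))%E.
Proof.
move=> Cj mD sE.
have mXD : measurable (X j @^-1` D).
  by rewrite -[_ @^-1` _]setTI; exact: measurable_funPT.
have PD : P (X j @^-1` D) \is a fin_num by exact: fin_num_measure.
have p0 : 0 <= fine (P (X j @^-1` D)) by exact: fine_ge0.
pose m1 : {measure set Om -> \bar R} := mrestr P mXD.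
pose m2 : {measure set Om -> \bar R} := mscale (NngNum p0) P.
have -> : (P E * P (X j @^-1` D) = m2 E)%E.
  by rewrite /m2/= /mscale/= fineK// muleC.
have -> : (P (E `&` X j @^-1` D) = m1 E)%E by [].
apply: (@g_sigma_algebra_measure_unique _ _ _ (cylinder C) _ (fun=> setT)) => //.
- exact: measurable_cylinder.
- move=> _; exists fset0, (fun=> setT); split => //.
    by rewrite set_fset0 bigcap_set0.
- by apply/seteqP; split => // w _; exists 0%N.
- exact: cylinderI.
- move=> A [J [B [mB JC ->]]]; rewrite /m1 /m2/= /mscale/= /mrestr fineK//.
  have jJ : j \notin J by apply/negP => /JC.
  have := @indepX (j |` J)%fset (fun i => if i == j then D else B i).
  rewrite big_fsetU1//= eqxx.
  rewrite (_ : \bigcap_(i in _) _ =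
    \bigcap_(i in [set` J]) X i @^-1` B i `&` X j @^-1` D); last first.
    apply/seteqP; split => w /=.
      move=> H; split.
        move=> i /= iJ; have := H i; rewrite /= !inE iJ orbT => /(_ isT).
        by case: eqP => // ij; move: jJ; rewrite -ij iJ.
      by have := H j; rewrite /= !inE eqxx => /(_ isT).
    move=> [H1 H2] i /=; rewrite !inE => /orP[/eqP ->|iJ]; first by rewrite eqxx.
    by case: eqP => [->//|_]; exact: H1.
  move=> ->; last by move=> i; case: ifP.
  congr (_ * _)%E; rewrite (@indepX J B)//.
  apply: eq_big_seq => i iJ.
  by case: eqP => // ij; move: jJ; rewrite -ij iJ.
- by move=> _; rewrite /m1/= /mrestr setTI (le_lt_trans (probability_le1 _ _))// ltry.
Qed.

(** Freezing: Y depends only on coordinates in C, so the joint law of Y and X j is a product and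
    Tonelli allows X j to be averaged first with Y held fixed. *)
Lemma indep_integral C j d' (S : measurableType d') (Y : Om -> S)
    (F : S * R -> \bar R) :
  ~ C j -> measurable_fun setT (Y : g_sigma_algebraType (cylinder C) -> S) ->
  measurable_fun [set: S * R] F -> (forall z, 0 <= F z)%E ->
  (\int[P]_w F (Y w, X j w) =
   \int[P]_w \int[distribution P (X j)]_x F (Y w, x))%E.
Proof.
move=> Cj mY mF F0.
have mY' : measurable_fun setT Y by exact: measurable_fun_sigma_cylinder mY.
have mXj : measurable_fun setT (X j) by exact: measurable_funPT.
have mZ : measurable_fun setT (fun w => (Y w, X j w)) by exact: measurable_fun_pair.
pose Ym : {mfun Om >-> S} :=
  HB.pack Y (isMeasurableFun.Build _ _ _ _ Y mY').
pose PY : probability S R := distribution P Ym.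
pose PX : probability R R := distribution P (X j).
have E1 : (\int[P]_w F (Y w, X j w) = \int[PY \x PX]_z F z)%E.
  rewrite -[LHS](@ge0_integral_pushforward _ _ _ _ _ _ mZ P setT F)//.
  apply/esym/eq_measure_integral => A mA _.
  apply: (@product_measure_unique _ _ _ _ _ PY PX (pushforward P (fun w => (Y w, X j w)))) => //.
  move=> B D mB mD; apply: (@cylinder_indep C _ _ (Y @^-1` B)) => //.
  by have := mY measurableT B mB; rewrite setTI.
rewrite E1 fubini_tonelli1// /fubini_F.
rewrite /PY /distribution ge0_integral_pushforward//.
- by apply: (@measurable_fun_fubini_tonelli_F _ _ _ _ _ PX).
- by move=> y _; exact: integral_ge0.
Qed.

End independence.

Lemma indep_prod_le d (Om : measurableType d) (R : realType)
    (P : probability Om R) (I : choiceType) (X : I -> {RV P >-> R})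
    (s : seq I) (f : I -> R -> R) (c : I -> R) :
  mutually_independent X -> uniq s ->
  (forall i, measurable_fun setT (f i)) -> (forall i x, 0 <= f i x) ->
  (forall i, i \in s ->
    (\int[distribution P (X i)]_x (f i x)%:E <= (c i)%:E)%E) ->
  (\int[P]_w (\prod_(i <- s) f i (X i w))%:E <= (\prod_(i <- s) c i)%:E)%E.
Proof.
move=> indepX + mf f0; elim: s => [|j s IH] /=.
  by move=> _ _; under eq_integral do rewrite big_nil; rewrite integral_cst//
    [X in (_ * X)%E](_ : _ = 1%E) ?mule1; [|exact: probability_setT]; rewrite big_nil.
move=> /andP[js us] fc.
pose Y w := \prod_(i <- s) f i (X i w).
(* The norm makes F nonnegative on the whole plane, as Tonelli requires; at the values of Y, which
   are nonnegative, it changes nothing. *)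
pose F (z : R * R) := (`|z.1| * f j z.2)%:E.
have Y0 w : 0 <= Y w by apply: prodr_ge0.
pose C : set I := [set` s].
have mY : measurable_fun setT (Y : g_sigma_algebraType (cylinder X C) -> R).
  rewrite /Y; apply: measurable_prod => i si.
  by apply: measurableT_comp => //; exact: measurable_coordinate.
have mF : measurable_fun [set: R * R] F.
  apply/measurable_EFinP; apply: measurable_funM.
    exact: measurableT_comp.
  exact: measurableT_comp.
have F0 z : (0 <= F z)%E by rewrite lee_fin mulr_ge0.
have Cj : ~ C j by move=> Cj; rewrite /C /= in Cj; rewrite Cj in js.
rewrite (_ : (fun w => _) = fun w => F (Y w, X j w)); last first.
  by apply/funext => w; rewrite /F /= big_cons ger0_norm// mulrC.
rewrite (indep_integral indepX Cj mY mF F0) big_cons EFinM.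
have cj0 : (0 <= (c j)%:E)%E.
  by apply: le_trans (fc j _); rewrite ?mem_head// integral_ge0// => x _; rewrite lee_fin.
have YP : measurable_fun setT Y by exact: measurable_fun_sigma_cylinder mY.
apply: (@le_trans _ _ (\int[P]_w ((c j)%:E * (Y w)%:E))%E).
  apply: ge0_le_integral => //.
  - by move=> w _; apply: integral_ge0.
  - have := @measurable_fun_fubini_tonelli_F _ _ _ _ R (distribution P (X j)) F mF F0.
    by move=> /measurableT_comp; exact.
  - by apply/measurable_EFinP; apply: measurable_funM.
  - move=> w _; rewrite /F /= ger0_norm//.
    under eq_integral do rewrite EFinM.
    rewrite ge0_integralZl_EFin//; last 2 first.
    + by move=> x _; rewrite lee_fin.
    + exact/measurable_EFinP.
    by rewrite muleC lee_wpmul2r// ?lee_fin// fc// mem_head.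
rewrite ge0_integralZl//; last 2 first.
- exact/measurable_EFinP.
- by move=> w _; rewrite lee_fin.
apply: lee_wpmul2l => //; apply: IH => // i si.
by apply: fc; rewrite inE si orbT.
Qed.

(** * Stationarity of the whole history *)

Section stationarity.
Context d (Om : measurableType d) (R : realType) (P : probability Om R).
Variable Q : queue P.

Definition customer (n : int) (w : Om) : R * R * R :=
  (interarrival Q n w, service Q n w, sojourn Q n w).

Definition rectangle : set (set (int -> R * R * R)) :=
  [set E | exists J : {fset int}, exists A : int -> set (R * R * R),
    (forall n, measurable (A n)) /\
    E = \bigcap_(n in [set` J]) [set x | A n (x n)]].

Lemma measurable_customer n : measurable_fun setT (customer n).
Proof. by do 2 (apply: measurable_fun_pair => //). Qed.

Lemma measurable_history k : measurable_fun setT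
  ((fun w n => customer (n + k) w) : Om -> g_sigma_algebraType rectangle).
Proof.
apply: measurability => //.
move=> _ [E [J [A [mA ->]]] <-]; rewrite setTI.
rewrite (_ : _ @^-1` _ =
    \bigcap_(n in [set` J]) (customer (n + k) @^-1` A n))//.
apply: fin_bigcap_measurable => // n _.
by rewrite -[_ @^-1` _]setTI; exact: measurable_customer.
Qed.

Lemma measurable_rectangle_coordinate n : measurable_fun setT
  ((fun x => x n) : g_sigma_algebraType rectangle -> R * R * R).
Proof.
move=> _ A mA; rewrite setTI; apply: sub_sigma_algebra.
exists [fset n]%fset, (fun=> A); split => //.
apply/seteqP; split => x /=; first by move=> xA j /= /[!inE] /eqP ->.
by move=> /(_ n); apply; rewrite /= ?inE ?eqxx.
Qed.

Lemma rectangleI : setI_closed rectangle.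
Proof.
move=> E F [J [A [mA ->]]] [K [B [mB ->]]].
exists (J `|` K)%fset.
exists (fun i => (if i \in J then A i else setT) `&`
                 (if i \in K then B i else setT)).
split.
- by move=> i; apply: measurableI; case: ifP.
- apply/seteqP; split => w /=.
    move=> [AJ BK] i /= _; split; case: ifP => // iH; [exact: AJ|exact: BK].
  move=> H; split => i /= iH.
    by have /= := H i; rewrite inE iH => /(_ isT)[].
  by have /= := H i; rewrite inE iH orbT => /(_ isT)[].
Qed.

(** [stationary] speaks of finitely many customers at a time, whereas the presence of some old
    customer involves infinitely many. The laws of the shifted and unshifted histories agree on the
    pi-system of rectangles, which suffices. *)
Lemma stationary_history k (E : set (int -> R * R * R)) :
  stationary Q -> <<s rectangle >> E ->
  P ((fun w n => customer (n + k) w) @^-1` E) =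
  P ((fun w n => customer n w) @^-1` E).
Proof.
move=> statQ sE.
have -> : (fun w n => customer n w) = (fun w n => customer (n + 0) w).
  by apply/funext => w; apply/funext => n; rewrite addr0.
pose h (k : int) : Om -> g_sigma_algebraType rectangle :=
  fun w n => customer (n + k) w.
pose H (k : int) : {mfun Om >-> g_sigma_algebraType rectangle} :=
  HB.pack (h k) (isMeasurableFun.Build _ _ _ _ (h k) (measurable_history k)).
pose m (k : int) : probability (g_sigma_algebraType rectangle) R := distribution P (H k).
change (m k E = m 0 E).
apply: (@g_sigma_algebra_measure_unique _ R (g_sigma_algebraType rectangle)
  rectangle _ (fun=> setT)) => //.
- by move=> F GF; exact: sub_sigma_algebra.
- move=> _; exists fset0, (fun=> setT); split => //.
  by rewrite set_fset0 bigcap_set0.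
- by apply/seteqP; split => // x _; exists 0%N.
- exact: rectangleI.
- move=> _ [J [A [mA ->]]].
  have HE j : m j (\bigcap_(n in [set` J]) [set x | A n (x n)]) =
      P (\bigcap_(n in [set` J]) (customer n @^-1` A n)).
    exact: (statQ j J A mA).
  exact: etrans (HE k) (esym (HE 0)).
- by move=> _; rewrite (le_lt_trans (probability_le1 _ _)) ?ltry.
Qed.

End stationarity.

(** * Sample paths *)

(* The customers -n, ..., m - 1. *)
Definition irange (n m : nat) : seq int := [seq i%:Z - n%:Z | i <- iota 0 (n + m)].

Lemma mem_irange n m (i : int) : (i \in irange n m) = (- n%:Z <= i < m%:Z).
Proof.
apply/mapP/idP => [[k + ->]|H].
  by rewrite mem_iota add0n => /andP[_]; lia.
exists `|(i + n%:Z)%R|%N; last by lia.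
by rewrite mem_iota add0n; lia.
Qed.

Lemma irange_uniq n m : uniq (irange n m).
Proof. by rewrite map_inj_uniq ?iota_uniq// => i j; lia. Qed.

Lemma size_irange n m : size (irange n m) = (n + m)%N.
Proof. by rewrite size_map size_iota. Qed.

Section service_path.
Context (R : realType) (T B V : int -> R) (r : int -> R -> R).
Hypothesis sp : service_path T B V r.

Local Notation mu := lebesgue_measure.
Local Notation served n a b := (\int[mu]_(s in `[a, b]) (r n s)%:E)%E.

Let mr D n : measurable_fun D (EFin \o r n).
Proof. apply/measurable_EFinP; apply: measurable_funTS; exact: (path_measurable sp). Qed.

Let r0 n t : (0 <= (r n t)%:E)%E.
Proof. by rewrite lee_fin; exact: (path_rate_ge0 sp). Qed.

Lemma sum_rate_le (s : seq int) t : uniq s -> \sum_(n <- s) r n t <= 1.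
Proof.
move=> us; rewrite -lee_fin; apply: le_trans (path_unit_rate sp t).
apply: esum_ge; exists [set` s]; first by split=> //; exact: finite_seq.
by rewrite -sumEFin fsbig_seq.
Qed.

Lemma total_rateE (s : seq int) t : uniq s ->
  (forall n, n \notin s -> r n t = 0) ->
  total_rate r t = (\sum_(n <- s) r n t)%:E.
Proof.
move=> us ps.
rewrite /total_rate -sumEFin (fsbig_seq _ _ us) -esum_fset//.
rewrite [RHS]esum_mkcond; apply: eq_esum => n _.
case: ifPn => // ns; rewrite ps//.
by apply: contra ns => ns; rewrite inE.
Qed.

Lemma sum_served_le (s : seq int) a b : uniq s -> a <= b ->
  (\sum_(n <- s) served n a b <= (b - a)%:E)%E.
Proof.
move=> us ab; rewrite -ge0_integral_sum//; last by move=> n; exact: mr.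
apply: (@le_trans _ _ (\int[mu]_(s in `[a, b]) (cst 1%:E) s)%E).
  apply: ge0_le_integral => //.
  - by move=> t _; apply: sume_ge0.
  - by apply: emeasurable_sum => n; exact: mr.
  - by move=> t _; rewrite sumEFin lee_fin sum_rate_le.
rewrite integral_cst//= mul1e lebesgue_measure_itv/= lte_fin.
by case: ifP => [_|_]; rewrite ?EFinB// lee_fin subr_ge0.
Qed.

Lemma served_ge0 n a b : (0 <= served n a b)%E.
Proof. by apply: integral_ge0. Qed.

Lemma served_le n a b : a <= b -> (served n a b <= (b - a)%:E)%E.
Proof.
by move=> ab; have := @sum_served_le [:: n] a b isT ab; rewrite big_seq1.
Qed.

Lemma served_fin n a b : served n a b \is a fin_num.
Proof.
have [ab|ba] := leP a b.
  by rewrite ge0_fin_numE ?served_ge0// (le_lt_trans (served_le n ab))// ltry.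
by rewrite set_itv_ge ?integral_set0// bnd_simp -ltNge.
Qed.

Lemma attainedE n t : (attained T r n t)%:E = served n (T n) t.
Proof. by rewrite /attained /Rintegral fineK// served_fin. Qed.

Lemma served_subset n a b c d : a <= c -> d <= b ->
  (served n c d <= served n a b)%E.
Proof.
move=> ac db; apply: ge0_subset_integral => //; first exact: mr.
move=> t /=; rewrite !in_itv/= => /andP[ct td].
by rewrite (le_trans ac ct) (le_trans td db).
Qed.

(** The rate of n vanishes outside its stay, so no window collects more than the integral over the
    stay, which is B n. *)
Lemma served_le_service n a b : (served n a b <= (B n)%:E)%E.
Proof.
rewrite -(path_served sp) attainedE.
rewrite integral_mkcond [leRHS]integral_mkcond.
apply: ge0_le_integral => //.
- by move=> t _; rewrite erestrict_ge0.
- by apply/(measurable_restrictT (EFin \o r n)).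
- by apply/(measurable_restrictT (EFin \o r n)).
- move=> t _; rewrite /= !patchE; case: ifPn => // _; case: ifPn => // tV.
  rewrite (path_rate_absent sp)// => /andP[Tt tTV].
  by case/negP: tV; rewrite inE/= in_itv/= Tt ltW.
Qed.

(* On [a, b] the server works at unit rate, and only on the customers in s. *)
Lemma busy_le (s : seq int) a b : uniq s -> a <= b ->
  work_conserving_path T B V r ->
  (forall t, a <= t <= b -> present T V t !=set0) ->
  (forall t n, a <= t <= b -> present T V t n -> n \in s) ->
  b - a <= \sum_(n <- s) B n.
Proof.
move=> us ab wc busy ps; rewrite -lee_fin.
apply: (@le_trans _ _ (\int[mu]_(t in `[a, b]) (\sum_(n <- s) (r n t)%:E))%E).
  rewrite (@eq_integral _ _ _ _ _ (cst 1%:E)).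
    rewrite integral_cst//= mul1e lebesgue_measure_itv/= lte_fin.
    by case: ltgtP ab => // -> _; rewrite subrr.
  move=> t; rewrite inE/= in_itv/= => tab.
  rewrite sumEFin -(total_rateE us); last first.
    move=> n ns; apply: (path_rate_absent sp) => np.
    by rewrite (ps t) in ns.
  apply: wc; apply: (path_waiting sp); exact: busy.
rewrite ge0_integral_sum//; last by move=> n; exact: mr.
by rewrite -sumEFin; apply: lee_sum => n _; exact: served_le_service.
Qed.

Lemma service_ge0 n : 0 <= B n.
Proof. by rewrite -lee_fin; apply: le_trans (served_le_service n 0 0); exact: served_ge0. Qed.

Hypothesis Tle : {homo T : i j / i <= j}.

(** A time t before 0 lies between some T (- k - 1) and T (- k) with k < N. The customer before - k
    who is still there after T (- k) arrived by T (- k - 1), so it is present at t. After time 0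
    customer 0 itself is present. *)
Lemma busy_since (N : nat) (x : R) : T 0 = 0 -> x < V 0 ->
  (forall k : nat, (k < N)%N ->
     exists2 m, m < - k%:Z & T (- k%:Z) < T m + V m) ->
  forall t, T (- N%:Z) <= t <= x -> present T V t !=set0.
Proof.
move=> T0 xV late t /andP[Nt tx].
have [t0|t0] := leP 0 t.
  by exists 0; rewrite /present/= T0 t0 add0r (le_lt_trans tx).
have ex : exists k : nat, T (- k%:Z) <= t by exists N.
have kt := ex_minnP ex; move: kt => [k kt kmin].
case: k kt kmin => [|k] kt kmin; first by rewrite oppr0 T0 leNgt t0 in kt.
have tk : t < T (- k%:Z).
  by rewrite ltNge; apply/negP => /kmin; rewrite ltnn.
have kN : (k < N)%N by apply: kmin.
have [m mk km] := late k kN.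
exists m; rewrite /present/= (lt_trans tk km) andbT (le_trans _ kt)//.
by apply: Tle; move: mk; lia.
Qed.

(* M is the last customer to arrive by time x. Customer 0 is present on [0, x],
   so the server is busy from the last epoch T (- n) at which everybody who came
   before - n had left; if n < N the work brought by - n, ..., M covers
   x - T (- n). Otherwise the server is busy since T (- N), and the customers who
   left by then, all those before - (N + K), do not contribute. *)
Lemma sojourn_work_le (N K M : nat) (x : R) :
  work_conserving_path T B V r -> T 0 = 0 -> 0 <= x < V 0 -> x < T (M.+1)%:Z ->
  (forall m, m < - (N + K)%N%:Z -> T m + V m <= T (- N%:Z)) ->
  (exists2 n : nat, (n < N)%N &
     x - T (- n%:Z) <= \sum_(i <- irange n M.+1) B i) \/
  x - T (- N%:Z) <= \sum_(i <- irange (N + K) M.+1) B i.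
Proof.
move=> wc T0 /andP[x0 xV] xM old.
have Tneg (n : nat) : T (- n%:Z) <= x.
  by rewrite (le_trans _ x0)// -T0; apply: Tle; lia.
pose p (n : nat) := `[< forall m, m < - n%:Z -> T m + V m <= T (- n%:Z) >].
have late k : ~~ p k -> exists2 m, m < - k%:Z & T (- k%:Z) < T m + V m.
  move=> /asboolPn/existsNP[m /not_implyP[mk /negP]]; rewrite -ltNge => ?.
  by exists m.
have [[n nN pn]|noempty] := pselect (exists2 n : nat, (n < N)%N & p n).
  left; have ex : exists n, p n by exists n.
  have := ex_minnP ex => -[k /asboolP pk kmin].
  exists k; first exact: leq_ltn_trans (kmin _ pn) nN.
  apply: busy_le => //; first exact: irange_uniq.
    apply: busy_since => // j jk; apply: late; apply/negP => /kmin.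
    by rewrite leqNgt jk.
  move=> t m /andP[kt tx] /andP[Tmt tTm]; rewrite mem_irange; apply/andP; split.
    rewrite leNgt; apply/negP => /pk H.
    by move: (lt_le_trans tTm H); rewrite ltNge kt.
  rewrite ltNge; apply/negP => /Tle H.
  by move: (le_lt_trans (le_trans H Tmt) (le_lt_trans tx xM)); rewrite ltxx.
right; apply: busy_le => //; first exact: irange_uniq.
  apply: busy_since => // j jN; apply: late; apply/negP => pj.
  by apply: noempty; exists j.
move=> t m /andP[kt tx] /andP[Tmt tTm]; rewrite mem_irange; apply/andP; split.
  rewrite leNgt; apply/negP => /old H.
  by move: (lt_le_trans tTm H); rewrite ltNge kt.
rewrite ltNge; apply/negP => /Tle H.
by move: (le_lt_trans (le_trans H Tmt) (le_lt_trans tx xM)); rewrite ltxx.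
Qed.

End service_path.

(** The truncated service time. The outer [Num.max 0] makes it nonnegative at every real argument,
    so that bounds on integrals against a law hold pointwise and not only almost surely. *)
Definition clip (R : realType) (b x : R) : R := Num.max 0 (Num.min x b).

Section foreground_background_path.
Context (R : realType) (T B V : int -> R) (r : int -> R -> R).
Hypothesis sp : service_path T B V r.
Hypothesis fb : fb_path T V r.
Local Notation mu := lebesgue_measure.
Local Notation served n a b := (\int[mu]_(s in `[a, b]) (r n s)%:E)%E.

Let finite_least t : finite_set (least_attained T V r t).
Proof. by apply: sub_finite_set (path_finite sp t) => n []. Qed.

(** The set of present customers is finite and nonempty, so some of them minimise the attained
    service, and these share rate 1 equally. *)
Lemma fb_work_conserving : work_conserving_path T B V r.
Proof.
move=> t [n0 n0t _].
have [m mt] : least_attained T V r t !=set0.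
  have fp := path_finite sp t.
  have n0p : n0 \in fset_set (present T V t) by rewrite in_fset_set// inE.
  pose F := fset_set (present T V t).
  have [m mmin] : exists m : F, forall j : F,
      attained T r (val m) t <= attained T r (val j) t.
    pose n1 : F := [` n0p]%fset.
    have := @arg_minP _ _ _ n1 xpredT (fun j : F => attained T r (val j) t) isT.
    by case=> m _ H; exists m => j; exact: H.
  exists (val m); split.
    by have := valP m; rewrite in_fset_set// inE.
  move=> j jp; have jF : j \in F by rewrite in_fset_set// inE.
  exact: (mmin [` jF]%fset).
rewrite (@total_rateE _ _ _ _ _ sp (fset_set (least_attained T V r t))) ?fset_uniq//.
  under eq_big_seq => j jL.
    rewrite fb indicE (_ : (j \in _) = true); last first.
      by rewrite in_fset_set// in jL.
    over.
  rewrite big_const_seq count_predT iter_addr_0 -[X in X%:E]mulr_natr [true%:R]mulr1n mul1r.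
  rewrite mulVf//.
  rewrite pnatr_eq0 cardfs_eq0; apply/eqP => L0.
  by have : m \in fset_set (least_attained T V r t);
    [rewrite in_fset_set// inE|rewrite L0 inE].
move=> j; rewrite in_fset_set// => jL.
by rewrite fb indicE (negbTE jL) mul0r.
Qed.

Lemma served_split n a b c : a <= b -> b <= c ->
  (served n a c <= served n a b + served n b c)%E.
Proof.
move=> ab bc.
have mr D : measurable_fun D (EFin \o r n).
  by apply/measurable_EFinP; apply: measurable_funTS; exact: path_measurable sp n.
have r0 t : (0 <= (r n t)%:E)%E by rewrite lee_fin; exact: path_rate_ge0 sp n t.
rewrite [in leLHS](@itv_bndbnd_setU _ _ _ (BRight b)) ?bnd_simp//.
rewrite ge0_integral_setU//=; last 2 first.
- exact: mr.
- by apply/disj_setPS => t [] /=; rewrite !in_itv/= => /andP[_ tb] /andP[]; rewrite ltNge tb.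
rewrite leeD2l//; apply: ge0_subset_integral => //; first exact: mr.
by move=> t /=; rewrite !in_itv/= => /andP[/ltW -> ->].
Qed.

(* If n had attained less than min b (B n) when customer 0 leaves, then n would
   still be present, and just before V 0 it would have attained less than
   customer 0, whose attained service is then close to B 0 >= b; FB would not
   serve customer 0 at that moment. *)
Lemma fb_served_ge b n : 0 < b <= B 0 -> T 0 = 0 -> 0 <= T n < V 0 ->
  clip b (B n) <= attained T r n (V 0).
Proof.
move=> /andP[b0 bB] T0 /andP[Tn0 Tnv].
have clipB : clip b (B n) <= B n by rewrite ge_max (service_ge0 sp)//= ge_min lexx.
have [nv|vn] := leP (T n + V n) (V 0).
  apply: (le_trans clipB).
  rewrite -lee_fin (attainedE sp) -(path_served sp) (attainedE sp).
  exact: (served_subset sp).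
have clipb : clip b (B n) <= b by rewrite ge_max ltW//= ge_min lexx orbT.
rewrite leNgt; apply/negP => lt_att.
have att0 : attained T r 0 (V 0) = B 0 by rewrite -(path_served sp) T0 add0r.
pose a := attained T r n (V 0).
have aB : a < B 0 by rewrite (lt_le_trans lt_att)// (le_trans clipb).
(* From t0 on customer 0 can still receive at most (B 0 - a) / 2, the rate being at most 1, so it
   has already attained more than a and hence more than n. *)
pose t0 := Num.max (T n) (V 0 - (B 0 - a) / 2).
have t0v : t0 < V 0 by rewrite gt_max Tnv/=; lra.
have t00 : 0 <= t0 by rewrite le_max Tn0.
have idle t : t0 <= t -> t < V 0 -> r 0 t = 0.
  move=> t0t tv; rewrite fb indicE memNset ?mul0r// => -[_ least].
  have pn : present T V t n.
    rewrite /present/= (lt_trans tv vn) andbT (le_trans _ t0t)//.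
    by rewrite le_max lexx.
  have := least n pn; apply/negP; rewrite -ltNge.
  have an : attained T r n t <= a.
    rewrite -lee_fin !(attainedE sp); apply: (served_subset sp) => //.
    exact: ltW.
  apply: (le_lt_trans an).
  have tpos : 0 <= t by rewrite (le_trans t00).
  have : ((B 0)%:E <= (attained T r 0 t)%:E + (V 0 - t)%:E)%E.
    rewrite -att0 !(attainedE sp) T0.
    apply: (le_trans (served_split 0 tpos (ltW tv))).
    by rewrite leeD2l// (served_le sp)// ltW.
  rewrite -EFinD lee_fin.
  have : V 0 - (B 0 - a) / 2 <= t by rewrite (le_trans _ t0t)// le_max lexx orbT.
  lra.
have B0 : 0 < B 0 by exact: lt_le_trans bB.
(* Idle after t0, customer 0 would have been served completely by t0, although it is still present
   then. *)
have : attained T r 0 t0 < B 0.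
  by apply: (path_unserved sp) => //; rewrite /present/= T0 t00 add0r t0v.
apply/negP; rewrite -leNgt -lee_fin -att0 !(attainedE sp) T0.
apply: (le_trans (served_split 0 t00 (ltW t0v))).
rewrite [X in (_ + X)%E](_ : _ = 0%E) ?adde0//.
apply: integral0_eq => t /=; rewrite in_itv/= => /andP[t0t].
rewrite le_eqVlt => /predU1P[->|tv]; last by rewrite idle.
by rewrite (path_rate_absent sp)// /present/= T0 add0r ltxx andbF.
Qed.

(** During [0, V 0] the server gives at least b to customer 0 and the clipped service time to each
    of the next k customers, all at total rate at most 1. *)
Lemma fb_sojourn_ge b k : {homo T : i j / i <= j} ->
  0 < b <= B 0 -> T 0 = 0 -> T k%:Z < V 0 ->
  b + \sum_(i < k) clip b (B i.+1%:Z) <= V 0.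
Proof.
move=> Tle bB T0 Tkv.
pose s : seq int := 0 :: [seq (i.+1)%:Z | i <- iota 0 k].
have us : uniq s.
  rewrite /= map_inj_uniq ?iota_uniq ?andbT; last by move=> i j; lia.
  by apply/negP => /mapP[i _]; lia.
have V0 : 0 <= V 0 by exact: path_sojourn_ge0 sp 0.
have := sum_served_le sp us V0; rewrite subr0 /s big_cons big_map.
rewrite -[iota 0 k](_ : index_iota 0 k = _) ?big_mkord; last by rewrite /index_iota subn0.
move=> H; rewrite -lee_fin; apply: le_trans H.
have /andP[b0 bB0] := bB.
rewrite EFinD leeD//.
  have -> : served 0 0%R (V 0) = (B 0)%:E.
    by rewrite -(path_served sp) (attainedE sp) T0 add0r.
  by rewrite lee_fin.
rewrite -sumEFin; apply: lee_sum => i _.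
have Ti0 : 0 <= T i.+1%:Z by rewrite -T0 Tle.
apply: (@le_trans _ _ (attained T r i.+1%:Z (V 0))%:E).
  rewrite lee_fin; apply: fb_served_ge => //; rewrite Ti0/=.
  by apply: le_lt_trans Tkv; apply: Tle; have := ltn_ord i; lia.
by rewrite (attainedE sp); exact: (served_subset sp).
Qed.

End foreground_background_path.

(** * Poisson arrivals *)

Section exponential.
Context d (Om : measurableType d) (R : realType) (P : probability Om R).
Context (lambda : R) (tau : {RV P >-> R}).
Hypothesis lambda_gt0 : 0 < lambda.
Hypothesis expo : forall A : set R, measurable A ->
  distribution P tau A = exponential_prob lambda A.
Local Notation mu := lebesgue_measure.

Let mpdf : measurable_fun setT (fun x => (exponential_pdf lambda x)%:E).
Proof. by apply/measurable_EFinP; exact: measurable_exponential_pdf. Qed.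

(** The law of tau is known on measurable sets only. Its Radon-Nikodym derivative and the
    exponential density have equal integrals over every such set, so they agree almost
    everywhere. *)
Lemma exponential_integral (f : R -> \bar R) :
  measurable_fun setT f -> (forall x, 0 <= f x)%E ->
  (\int[distribution P tau]_x f x =
   \int[mu]_x (f x * (exponential_pdf lambda x)%:E))%E.
Proof.
move=> mf f0.
pose tauT : {mfun Om >-> measurableTypeR R} :=
  HB.pack (tau : Om -> measurableTypeR R)
    (isMeasurableFun.Build _ _ Om (measurableTypeR R) tau (measurable_funPT tau)).
pose nu : {finite_measure set (measurableTypeR R) -> \bar R} :=
  distribution P tauT.
pose leb : {sigma_finite_measure set (measurableTypeR R) -> \bar R} :=
  @lebesgue_measure R.
have nuE A : measurable A -> nu A = exponential_prob lambda A by exact: expo.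
have numu : nu `<< mu.
  apply/null_content_dominatesP => N mN N0.
  by rewrite nuE//; apply: null_set_integral => //; exact: measurable_funTS.
have -> : (\int[distribution P tau]_x f x = \int[nu]_x f x)%E.
  rewrite ge0_integral_distribution//.
  by rewrite /nu ge0_integral_distribution.
pose g := Radon_Nikodym_SigmaFinite.f nu leb.
have intg : leb.-integrable setT g.
  exact: (Radon_Nikodym_SigmaFinite.f_integrable numu).
rewrite -(Radon_Nikodym_SigmaFinite.change_of_variables numu)//.
apply: ae_eq_integral => //.
- by apply: emeasurable_funM => //; exact: measurable_int intg.
- exact: emeasurable_funM.
- apply: ae_eqe_mul2l; apply: integral_ae_eq => // A _ mA.
  by rewrite -(Radon_Nikodym_SigmaFinite.f_integral numu)// nuE.
Qed.

Lemma exponential_ge0 : {ae P, forall w, 0 <= tau w}.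
Proof.
exists (tau @^-1` `]-oo, 0[); split.
- by rewrite -[_ @^-1` _]setTI; exact: measurable_funPT.
- have -> : P (tau @^-1` `]-oo, 0[) = distribution P tau `]-oo, 0[ by [].
  rewrite expo//; apply: integral0_eq => x /=; rewrite in_itv/= => x0.
  by rewrite lt0_exponential_pdf.
- by move=> w /= /negP; rewrite -ltNge in_itv/=.
Qed.

(** The tilt exp (- s x) turns the density of rate lambda into lambda / (lambda + s) times the
    density of rate lambda + s. *)
Lemma exponential_laplace s : 0 <= s ->
  (\int[distribution P tau]_x (expR (- (s * x)))%:E =
   (lambda / (lambda + s))%:E)%E.
Proof.
move=> s0; have ls : 0 < lambda + s by rewrite ltr_wpDr.
rewrite exponential_integral; last 2 first.
- apply/measurable_EFinP; apply: measurableT_comp => //.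
  by apply: measurableT_comp => //; exact: measurable_funM.
- by move=> x; rewrite lee_fin expR_ge0.
transitivity (\int[mu]_x ((lambda / (lambda + s))%:E *
    (exponential_pdf (lambda + s) x)%:E))%E.
  apply: eq_integral => x _; rewrite -!EFinM; congr _%:E.
  have [x0|x0] := ltP x 0; first by rewrite !lt0_exponential_pdf// !mulr0.
  rewrite !exponential_pdfE//.
  rewrite [RHS]mulrA divfK ?gt_eqF// mulrCA -expRD; congr (_ * expR _).
  by ring.
rewrite ge0_integralZl//=.
- by rewrite integral_exponential_pdf// mule1.
- by apply/measurable_EFinP; exact: measurable_exponential_pdf.
- by move=> x _; rewrite lee_fin exponential_pdf_ge0 ?ltW.
- by rewrite lee_fin divr_ge0// ltW.
Qed.

End exponential.

(** The older block is written as a shift of [irange k 0], the form it takes in a history shifted by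
    n customers. *)
Lemma perm_irange_cat (k n m : nat) :
  perm_eq (irange (n + k) m) ([seq i - n%:Z | i <- irange k 0] ++ irange n m).
Proof.
apply: uniq_perm; first exact: irange_uniq.
  rewrite cat_uniq irange_uniq andbT map_inj_uniq ?irange_uniq/=; last first.
    by move=> i j; lia.
  apply/hasPn => i; rewrite mem_irange => /andP[ni _].
  by apply/negP => /mapP[j]; rewrite mem_irange; lia.
move=> i; rewrite mem_cat !mem_irange.
apply/idP/orP => [H|[/mapP[j]|]]; last by lia.
  have [iN|iN] := leP (- n%:Z) i; [right; lia|left].
  by apply/mapP; exists (i + n%:Z); rewrite ?mem_irange; lia.
by rewrite mem_irange; lia.
Qed.

Lemma measurable_le_set d (T : measurableType d) (R : realType) (f g : T -> R) :
  measurable_fun setT f -> measurable_fun setT g ->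
  measurable [set w | f w <= g w].
Proof.
move=> mf mg.
have := @measurable_fun_ler _ _ _ setT f g mf mg measurableT [set true].
by rewrite setTI; exact.
Qed.

Lemma measurable_lt_set d (T : measurableType d) (R : realType) (f g : T -> R) :
  measurable_fun setT f -> measurable_fun setT g ->
  measurable [set w | f w < g w].
Proof.
move=> mf mg.
have := @measurable_fun_ltr _ _ _ setT f g mf mg measurableT [set true].
by rewrite setTI; exact.
Qed.

Lemma ae_le_measure d (T : measurableType d) (R : realType)
    (mu : {measure set T -> \bar R}) (A C : set T) :
  measurable A -> measurable C -> {ae mu, forall w, A w -> C w} ->
  (mu A <= mu C)%E.
Proof.
move=> mA mC [N [mN N0 AN]].
apply: (@le_trans _ _ (mu (C `|` N))).
  apply: le_measure; rewrite ?inE//; first exact: measurableU.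
  move=> w Aw; have [Cw|Cw] := pselect (C w); first by left.
  by right; apply: AN => /(_ Aw).
by rewrite (le_trans (measureU2 _ _ _))// [X in (_ + X)%E]N0 adde0.
Qed.

Section arrivals.
Context d (Om : measurableType d) (R : realType) (P : probability Om R).
Variable Q : queue P.

Lemma arrival_neg (n : nat) w :
  arrival Q (- n%:Z) w = - \sum_(i <- irange n 0) interarrival Q i w.
Proof.
case: n => [|n]; first by rewrite big_nil !oppr0 /= big_ord0.
rewrite -NegzE /=; congr (- _).
rewrite -(big_mkord xpredT (fun i => interarrival Q (Negz i) w)).
rewrite -(big_map Negz xpredT (fun i => interarrival Q i w)).
apply: perm_big; apply: uniq_perm; rewrite ?irange_uniq//.
  by rewrite map_inj_uniq ?iota_uniq// => i j [].
move=> i; rewrite mem_irange; apply/mapP/idP => [[j]|].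
  by rewrite mem_index_iota => + ->; rewrite NegzE; lia.
case: i => [i|i]; first by lia.
by rewrite NegzE => ?; exists i; rewrite ?mem_index_iota; [lia|rewrite NegzE].
Qed.

Lemma arrival_pos (n : nat) w :
  arrival Q n%:Z w = \sum_(i <- irange 0 n) interarrival Q i w.
Proof.
rewrite /= /irange big_map -(big_mkord xpredT (fun i => interarrival Q (Posz i) w)).
rewrite /index_iota subn0 add0n.
by apply: eq_bigr => i _; rewrite subr0.
Qed.

Lemma arrival0 w : arrival Q 0 w = 0.
Proof. by rewrite /= big_ord0. Qed.

Lemma arrivalS (i : int) w :
  arrival Q (i + 1) w = arrival Q i w + interarrival Q i w.
Proof.
case: i => [n|n].
  by rewrite (_ : Posz n + 1 = Posz n.+1) ?/= ?big_ord_recr//; lia.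
case: n => [|n].
  rewrite (_ : Negz 0 + 1 = 0)// arrival0 /= big_ord_recr big_ord0 /= add0r.
  by rewrite addNr.
rewrite (_ : Negz n.+1 + 1 = Negz n); last by lia.
by rewrite /= [in RHS]big_ord_recr/= opprD addrNK.
Qed.

Lemma arrival_homo w : (forall n, 0 <= interarrival Q n w) ->
  {homo arrival Q ^~ w : i j / i <= j}.
Proof.
move=> tau0 i j ij.
have -> : j = i + `|j - i|%N%:Z by lia.
elim: `|j - i|%N => [|k IH]; first by rewrite addr0.
apply: (le_trans IH).
by rewrite (_ : i + k.+1%:Z = (i + k%:Z) + 1) ?arrivalS ?lerDl//; lia.
Qed.

Lemma arrival_diff (N k : nat) w :
  arrival Q (- N%:Z) w - arrival Q (- (N + k)%N%:Z) w =
  \sum_(i <- irange k 0) interarrival Q (i - N%:Z) w.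
Proof.
rewrite !arrival_neg (perm_big _ (perm_irange_cat k N 0)) big_cat/= big_map.
by rewrite opprK addrCA addNr addr0.
Qed.

Lemma measurable_arrival n : measurable_fun setT (arrival Q n).
Proof.
case: n => n /=; first by apply: measurable_sum => i.
by apply: measurableT_comp => //; apply: measurable_sum => i.
Qed.

Lemma interarrival_ge0 (lambda : R) :
  (forall n (A : set R), measurable A ->
    distribution P (interarrival Q n) A = exponential_prob lambda A) ->
  {ae P, forall w, forall n, 0 <= interarrival Q n w}.
Proof.
move=> expo; have tau0 n := exponential_ge0 (@expo n).
have := ae_foralln (fun n => tau0 (Negz n)).
have := ae_foralln (fun n => tau0 (Posz n)).
by apply: filterS2 => w H1 H2 [n|n]; [exact: H1|exact: H2].
Qed.

End arrivals.

(** * The upper bound for work-conserving disciplines *)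

(** Markov's inequality for a product of independent weights. The weight depends on the index, so
    interarrival and service times of different customers may be tilted differently. *)
Lemma chernoff d (Om : measurableType d) (R : realType)
    (P : probability Om R) (I : choiceType) (X : I -> {RV P >-> R})
    (s : seq I) (f : I -> R -> R) (c : I -> R) (E : set Om) (K : R) :
  mutually_independent X -> uniq s ->
  (forall i, measurable_fun setT (f i)) -> (forall i x, 0 <= f i x) ->
  (forall i, i \in s ->
    (\int[distribution P (X i)]_x (f i x)%:E <= (c i)%:E)%E) ->
  measurable E -> 0 < K ->
  (forall w, E w -> K <= \prod_(i <- s) f i (X i w)) ->
  (P E <= (K^-1 * \prod_(i <- s) c i)%:E)%E.
Proof.
move=> indepX us mf f0 fc mE K0 EK.
rewrite EFinM lee_pdivlMl//.
apply: le_trans (indep_prod_le indepX us mf f0 fc).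
rewrite -(@setIT _ E) -integral_indic// -ge0_integralZl//=; last 2 first.
- exact/measurable_EFinP.
- by rewrite lee_fin ltW.
apply: ge0_le_integral => //.
- by move=> w _; rewrite lee_fin mulr_ge0// ltW.
- by apply/measurable_EFinP; apply: measurable_funM => //; exact: measurable_indic.
- apply/measurable_EFinP; apply: measurable_prod => i _.
  exact: measurableT_comp.
- move=> w _; rewrite lee_fin indicE.
  case: (boolP (w \in E)) => [/set_mem/EK|_]; first by rewrite mulr1.
  by rewrite mulr0; apply: prodr_ge0.
Qed.

Lemma prod_cst (R : realType) (J : eqType) (t : seq J) (c : R) :
  \prod_(i <- t) c = c ^+ size t.
Proof. by rewrite big_const_seq count_predT -Monoid.iteropE. Qed.

(** For fixed x this decays geometrically in J. In both bounds it cuts off the number of arrivals by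
    time x. *)
Lemma arrivals_before_le d (Om : measurableType d) (R : realType)
    (P : probability Om R) (Q : queue P) (lambda s : R) (J : nat) (x : R) :
  0 < lambda -> mutually_independent (queue_input Q) ->
  (forall n (A : set R), measurable A ->
    distribution P (interarrival Q n) A = exponential_prob lambda A) ->
  0 < s ->
  (P [set w | (arrival Q J%:Z w <= x)%R] <=
   (expR (s * x) * (lambda / (lambda + s)) ^+ J)%:E)%E.
Proof.
move=> lambda0 indepQ expo s0.
pose f (i : int + int) (y : R) := expR (- s * y).
have mf i : measurable_fun setT (f i).
  by apply: measurableT_comp => //; exact: measurable_funM.
pose c (i : int + int) := lambda / (lambda + s).
have := @chernoff _ _ _ _ _ _ [seq inl i | i <- irange 0 J] f c
  [set w | (arrival Q J%:Z w <= x)%R] (expR (- s * x)) indepQ _ mf (fun i y => expR_ge0 _).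
rewrite prod_cst size_map size_irange add0n mulNr -expRN opprK; apply.
- by rewrite map_inj_uniq ?irange_uniq// => i j [].
- move=> _ /mapP[n _ ->]; rewrite -(exponential_laplace lambda0 (@expo n) (ltW s0)).
  by rewrite /f; under eq_integral do rewrite mulNr.
- by apply: measurable_le_set => //; exact: measurable_arrival.
- exact: expR_gt0.
- move=> w /= Jx; rewrite (big_map inl) /f -expR_sum -mulr_sumr ler_expR.
  by rewrite -arrival_pos !mulNr lerN2 ler_pM2l.
Qed.

Section chernoff_bounds.
Context d (Om : measurableType d) (R : realType) (P : probability Om R).
Context (Q : queue P) (lambda m theta s : R).
Hypothesis lambda_gt0 : 0 < lambda.
Hypothesis indepQ : mutually_independent (queue_input Q).
Hypothesis expo : forall n (A : set R), measurable A ->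
  distribution P (interarrival Q n) A = exponential_prob lambda A.
Hypothesis mgf : forall n,
  (\int[distribution P (service Q n)]_x (expR (theta * x))%:E <= m%:E)%E.
Hypothesis s_gt0 : 0 < s.
Hypothesis s_lt_theta : s < theta.
Hypothesis stable : lambda * m < lambda + s.

(** Each customer contributes a factor m for its service time and at most lambda / (lambda + s) for
    its interarrival time. [stable] says that the product q is below 1, so that the bounds can be
    summed. *)
Let q := lambda * m / (lambda + s).

Let ls0 : 0 < lambda + s. Proof. exact: addr_gt0. Qed.
Let theta0 : 0 < theta. Proof. exact: lt_trans s_lt_theta. Qed.

Let m_ge0 : 0 <= m.
Proof.
rewrite -lee_fin; apply: le_trans (mgf 0).
by apply: integral_ge0 => x _; rewrite lee_fin expR_ge0.
Qed.

Let q0 : 0 <= q.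
Proof. by rewrite /q; apply: divr_ge0; [apply: mulr_ge0|]; rewrite ?m_ge0 ?ltW. Qed.
Let q1 : q < 1. Proof. by rewrite ltr_pdivrMr ?mul1r. Qed.

Let mexp (a : R) : measurable_fun setT (fun x : R => expR (a * x)).
Proof. by apply: measurableT_comp => //; exact: measurable_funM. Qed.

(* For t before 0 the inequality x - t <= work is tilted by theta, whereas the
   interarrival times after 0 only have to satisfy T M <= x, tilted by s. *)
Let weight (i : int + int) (x : R) : R :=
  match i with
  | inl n => if n < 0 then expR (- theta * x) else expR (- s * x)
  | inr _ => expR (theta * x)
  end.

Let cost (i : int + int) : R :=
  match i with
  | inl n => if n < 0 then lambda / (lambda + theta) else lambda / (lambda + s)
  | inr _ => m
  end.

Let mweight i : measurable_fun setT (weight i).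
Proof. by case: i => n; rewrite /weight; [case: (n < 0)|]; apply: mexp. Qed.

Let weight_ge0 i x : 0 <= weight i x.
Proof. by case: i => n /=; [case: ifP|]; rewrite expR_ge0. Qed.

Let weight_cost i :
  (\int[distribution P (queue_input Q i)]_x (weight i x)%:E <= (cost i)%:E)%E.
Proof.
case: i => n /=; last exact: mgf.
case: (n < 0).
- rewrite -(exponential_laplace lambda_gt0 (@expo n) (ltW theta0)).
  by under eq_integral do rewrite mulNr.
- rewrite -(exponential_laplace lambda_gt0 (@expo n) (ltW s_gt0)).
  by under eq_integral do rewrite mulNr.
Qed.

Let keys (n j M : nat) : seq (int + int) :=
  [seq inl i | i <- irange n M] ++ [seq inr i | i <- irange j M.+1].

(** Adding theta times the inequality on the work and s times x - T M >= 0 shows that the weights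
    multiply to at least exp ((theta - s) x). The j customers before - n contribute service times
    only, hence the extra powers of m; the factor lambda / (lambda + theta) of the n interarrival
    times before 0 is weakened to lambda / (lambda + s) to produce q ^ n. *)
Lemma backlog_le (n j M : nat) (x : R) :
  (P [set w | (arrival Q M%:Z w <= x)%R /\
      (x - arrival Q (- n%:Z) w <= \sum_(i <- irange (n + j) M.+1) service Q i w)%R] <=
   (expR (- ((theta - s) * x)) * m ^+ j.+1 * q ^+ n * q ^+ M)%:E)%E.
Proof.
set E := (X in P X).
have pc : perm_eq (irange n M) ([seq i - 0 | i <- irange n 0] ++ irange 0 M).
  exact: (perm_irange_cat n 0 M).
have := @chernoff _ _ _ _ _ _ (keys n (n + j) M) weight cost E (expR ((theta - s) * x)) indepQ _ mweight weight_ge0.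
move=> H; apply: le_trans (H _ _ _ _ _) _ => {H}.
- rewrite cat_uniq; apply/and3P; split.
  + by rewrite map_inj_uniq ?irange_uniq// => a b [].
  + by apply/hasPn => a /mapP[b _ ->]; apply/negP => /mapP[].
  + by rewrite map_inj_uniq ?irange_uniq// => a b [].
- by move=> i _; exact: weight_cost.
- apply: measurableI.
    by apply: measurable_le_set => //; exact: measurable_arrival.
  apply: measurable_le_set; last by apply: measurable_sum => i.
  by apply: measurable_funB => //; exact: measurable_arrival.
- exact: expR_gt0.
- move=> w [Mx xB].
  rewrite big_cat/= (big_map inl) (big_map inr)/= -expR_sum -mulr_sumr.
  rewrite (perm_big _ pc) big_cat/= (big_map (fun i => i - 0)).
  rewrite (@eq_big_seq _ _ _ _ (irange n 0) _ (fun i => expR (- theta * interarrival Q i w))); last first.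
    by move=> i; rewrite mem_irange /= subr0 => /andP[_ ->].
  rewrite (@eq_big_seq _ _ _ _ (irange 0 M) _ (fun i => expR (- s * interarrival Q i w))); last first.
    by move=> i; rewrite mem_irange /= => /andP[]; rewrite oppr0 leNgt => /negbTE ->.
  rewrite -!expR_sum -!mulr_sumr -arrival_pos -!expRD ler_expR.
  rewrite arrival_neg opprK in xB.
  move: xB Mx; set b := \sum_(i <- _) _; set a := \sum_(i <- _) _ => xB Mx.
  have := ler_wpM2l (ltW theta0) xB; have := ler_wpM2l (ltW s_gt0) Mx; lra.
- rewrite lee_fin -expRN -!mulrA ler_pM2l ?expR_gt0//.
  rewrite big_cat/= (big_map inl) (big_map inr)/= (perm_big _ pc) big_cat/= (big_map (fun i => i - 0)).
  rewrite (@eq_big_seq _ _ _ _ (irange n 0) _ (fun i => lambda / (lambda + theta))); last first.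
    by move=> i; rewrite mem_irange /= subr0 => /andP[_ ->].
  rewrite (@eq_big_seq _ _ _ _ (irange 0 M) _ (fun i => lambda / (lambda + s))); last first.
    by move=> i; rewrite mem_irange /= => /andP[]; rewrite oppr0 leNgt => /negbTE ->.
  rewrite !prod_cst !size_irange addn0 add0n.
  have a0 : 0 <= lambda / (lambda + theta) by rewrite divr_ge0 ?ltW// addr_gt0.
  have as_ : lambda / (lambda + theta) <= lambda / (lambda + s).
    by rewrite ler_pM2l// lef_pV2 ?posrE ?addr_gt0// lerD2l ltW.
  have -> : q = lambda / (lambda + s) * m by rewrite /q mulrAC.
  have al0 : 0 <= lambda / (lambda + s) by rewrite divr_ge0// ltW.
  move: a0 as_ al0; move: (lambda / (lambda + theta)) (lambda / (lambda + s)).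
  move=> a al a0 aal al0.
  rewrite !exprMn; have -> : (n + j + M.+1 = j.+1 + n + M)%N by lia.
  rewrite !exprD [leRHS](_ : _ = al ^+ n * al ^+ M * (m ^+ j.+1 * m ^+ n * m ^+ M)).
    apply: ler_wpM2r; first by rewrite !mulr_ge0// exprn_ge0.
    apply: ler_wpM2r; first by rewrite exprn_ge0.
    by rewrite lerXn2r.
  by ring.
Qed.

End chernoff_bounds.

(** * Customers from the distant past *)

Section old_customers.
Context (R : realType).

(* Seen from customer 0 at time 0: some customer before - K is still present.
   Stationarity makes the probability of this the same seen from any customer. *)
Definition old_present (K : nat) : set (int -> R * R * R) :=
  [set x | exists j : nat, \sum_(i <- irange (K.+1 + j) 0) (x i).1.1 <
                           (x (- (K.+1 + j)%N%:Z)).2].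

Context d (Om : measurableType d) (P : probability Om R).
Variable Q : queue P.
Notation T := (arrival Q).
Notation V := (sojourn Q).

Lemma sigma_old_present K : <<s @rectangle R >> (old_present K).
Proof.
suff : measurable (old_present K : set (g_sigma_algebraType (@rectangle R))) by [].
rewrite (_ : old_present K = \bigcup_j [set x |
  \sum_(i <- irange (K.+1 + j) 0) (x i).1.1 < (x (- (K.+1 + j)%N%:Z)).2]); last first.
  by apply/seteqP; split => x; [move=> [j ?]; exists j|move=> [j _ ?]; exists j].
apply: bigcupT_measurable => j; apply: measurable_lt_set.
  apply: measurable_sum => i.
  have mi := @measurable_rectangle_coordinate R i.
  exact: (measurableT_comp (measurableT_comp measurable_fst measurable_fst) mi).
have mi := @measurable_rectangle_coordinate R (- (K.+1 + j)%N%:Z).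
exact: (measurableT_comp measurable_snd mi).
Qed.

Lemma not_old_present (N K : nat) w :
  ~ old_present K (fun n => customer Q (n + - N%:Z) w) ->
  forall m, m < - (N + K)%N%:Z -> T m w + V m w <= T (- N%:Z) w.
Proof.
move=> nold m mNK; rewrite leNgt; apply/negP => late; apply: nold.
exists (`|m|%N - N - K.+1)%N.
set k := (K.+1 + _)%N.
have kE : m = - (N + k)%N%:Z by rewrite /k; lia.
rewrite /= -arrival_diff -kE.
by rewrite (_ : - k%:Z + - N%:Z = m) ?ltrBlDl// kE; lia.
Qed.

Lemma old_present_prob K N : stationary Q ->
  P ((fun w n => customer Q (n + - N%:Z) w) @^-1` old_present K) =
  P ((fun w n => customer Q n w) @^-1` old_present K).
Proof. by move=> statQ; apply: stationary_history => //; exact: sigma_old_present. Qed.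

Lemma measurable_old_present K k :
  measurable ((fun w n => customer Q (n + k) w) @^-1` old_present K).
Proof.
rewrite -[X in measurable X]setTI.
exact: (@measurable_history _ _ _ _ Q k measurableT _ (sigma_old_present K)).
Qed.

(** The events decrease in K, and on their intersection customers of arbitrarily large negative
    index would all be present at time 0, against [path_finite]. Continuity of P from above then
    yields K. *)
Lemma old_present_vanish (e : R) :
  {ae P, forall w, forall n, 0 <= interarrival Q n w} -> valid Q -> 0 < e ->
  exists K, (P ((fun w n => customer Q n w) @^-1` old_present K) <= e%:E)%E.
Proof.
move=> taus validQ e0.
pose F K := (fun w n => customer Q n w) @^-1` old_present K.
have mF K : measurable (F K).
  have := measurable_old_present K 0.
  by rewrite /F; under [in X in X -> _]eq_fun do under eq_fun do rewrite addr0.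
have mFF : measurable (\bigcap_K F K) by apply: bigcapT_measurable.
have F0 : (P (\bigcap_K F K) = 0)%E.
  apply/eqP; rewrite -measure_le0 -(measure0 P).
  apply: ae_le_measure => //.
  move: taus validQ; apply: filterS2 => w /arrival_homo Tle sp Fw.
  have := path_finite sp 0 => finA.
  pose K := \max_(i <- fset_set (present (T ^~ w) (V ^~ w) 0)) `|i|%N.
  have [j late] := Fw K I.
  have : (`|- (K.+1 + j)%N%:Z|%N <= K)%N.
    apply: leq_bigmax_seq => //; rewrite in_fset_set// inE.
    apply/andP; split; first by have := Tle (- (K.+1 + j)%N%:Z) 0; rewrite arrival0; apply; lia.
    by rewrite -ltrBlDl sub0r arrival_neg opprK.
  by lia.
have ndF : nonincreasing_seq F.
  move=> a b ab; apply/subsetPset => w [j jb]; exists (b - a + j)%N.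
  by rewrite (_ : (a.+1 + (b - a + j) = b.+1 + j)%N)//; lia.
have Fy : (P (F 0%N) < +oo)%E by rewrite (le_lt_trans (probability_le1 _ _)) ?ltry.
have Fc : (P \o F) @ \oo --> P (\bigcap_K F K).
  exact: nonincreasing_cvg_mu.
move: Fc; rewrite F0 => /fine_cvg /cvgr_lt => /(_ _ e0) [K _ HK]; exists K.
have := HK K (leqnn K); rewrite /= => /ltW.
by rewrite -lee_fin fineK ?fin_num_measure.
Qed.

End old_customers.

Lemma sum_geometric_le (R : realFieldType) (q : R) (N : nat) :
  0 <= q < 1 -> \sum_(n < N) q ^+ n <= (1 - q)^-1.
Proof.
move=> /andP[q0 q1]; rewrite -[leRHS]mul1r ler_pdivlMr ?subr_gt0// mulrC.
have := subrX1 q N; rewrite -opprB -[X in _ = X * _]opprB mulNr => /oppr_inj <-.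
by rewrite gerBl exprn_ge0.
Qed.

Lemma Boole_le d (T : measurableType d) (R : realType)
    (mu : {measure set T -> \bar R}) (A : nat -> set T) (c : nat -> R) (N : nat) :
  (forall n, measurable (A n)) -> (forall n, (mu (A n) <= (c n)%:E)%E) ->
  (mu (\big[setU/set0]_(n < N) A n) <= (\sum_(n < N) c n)%:E)%E.
Proof.
move=> mA Ac; apply: le_trans (Boole_inequality _ _) _ => //.
by rewrite -sumEFin; apply: lee_sum => n _; exact: Ac.
Qed.

Lemma exists_geometric_le (R : realType) (a q e : R) :
  0 <= q < 1 -> 0 < e -> exists n : nat, a * q ^+ n <= e.
Proof.
move=> /andP[q0 q1] e0.
have := @cvg_geometric R a q; rewrite ger0_norm// => /(_ q1).
move=> /cvgr_le => /(_ _ e0) [n _ Hn]; exists n.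
exact: (Hn n (leqnn n)).
Qed.

(** For fixed x three events are made unlikely: a customer before - (N + K) still present at T (-
    N), the second alternative of [sojourn_work_le], and T J <= x. The remaining event is bounded by
    geometric series in n and in M, whence C = m / (1 - q) ^ 2. As C does not depend on K, N and J,
    the error e can tend to 0. *)
Lemma sojourn_tail_le d (Om : measurableType d) (R : realType)
    (P : probability Om R) (Q : queue P) (lambda m theta s : R) :
  0 < lambda -> mutually_independent (queue_input Q) ->
  (forall n (A : set R), measurable A ->
    distribution P (interarrival Q n) A = exponential_prob lambda A) ->
  (forall n,
    (\int[distribution P (service Q n)]_x (expR (theta * x))%:E <= m%:E)%E) ->
  0 < s -> s < theta -> lambda * m < lambda + s ->
  stationary Q -> valid Q -> work_conserving Q ->
  exists C, forall x, 0 <= x ->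
    (P [set w | (x < sojourn Q 0 w)%R] <= (C * expR (- ((theta - s) * x)))%:E)%E.
Proof.
move=> lambda0 indepQ expo mgf s0 st stable statQ validQ wcQ.
pose q := lambda * m / (lambda + s).
have ls0 : 0 < lambda + s by exact: addr_gt0.
have m0 : 0 <= m.
  rewrite -lee_fin; apply: le_trans (mgf 0).
  by apply: integral_ge0 => x _; rewrite lee_fin expR_ge0.
have q01 : 0 <= q < 1.
  by rewrite divr_ge0 ?(mulr_ge0 (ltW lambda0) m0) ?ltW//= ltr_pdivrMr// mul1r.
have as01 : 0 <= lambda / (lambda + s) < 1.
  by rewrite divr_ge0 ?ltW//= ltr_pdivrMr// mul1r ltrDl.
have q1 : 0 < 1 - q by rewrite subr_gt0; case/andP: q01.
have qge0 : 0 <= q by case/andP: q01.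
have taus := interarrival_ge0 expo.
exists (m * (1 - q)^-1 * (1 - q)^-1) => x x0.
set a := expR _.
have a0 : 0 < a by exact: expR_gt0.
apply/lee_addgt0Pr => e e0; pose e3 := e / 3.
have e30 : 0 < e3 by rewrite divr_gt0.
(* K is chosen before N, since N has to beat the factor m ^+ K.+1. By stationarity the bound for K
   serves at the epoch T (- N) whatever N is. *)
have [K PK] := old_present_vanish taus validQ e30.
have [N PN] := exists_geometric_le (a * m ^+ K.+1 * (1 - q)^-1) q01 e30.
have [J PJ] := exists_geometric_le (expR (s * x)) as01 e30.
pose E n j M := [set w | (arrival Q M%:Z w <= x)%R /\
  (x - arrival Q (- n%:Z) w <= \sum_(i <- irange (n + j) M.+1) service Q i w)%R].
have mE n j M : measurable (E n j M).
  apply: measurableI.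
    by apply: measurable_le_set => //; exact: measurable_arrival.
  apply: measurable_le_set; last by apply: measurable_sum => i.
  by apply: measurable_funB => //; exact: measurable_arrival.
pose A0 := \big[setU/set0]_(n < N) \big[setU/set0]_(M < J) E n 0%N M.
pose A1 := \big[setU/set0]_(M < J) E N K M.
pose A2 := [set w | (arrival Q J%:Z w <= x)%R].
pose A3 := (fun w n => customer Q (n + - N%:Z) w) @^-1` old_present K.
have mA0 : measurable A0 by do 2 (apply: bigsetU_measurable => ? _).
have mA1 : measurable A1 by apply: bigsetU_measurable => ? _.
have mA2 : measurable A2.
  by apply: measurable_le_set => //; exact: measurable_arrival.
have mA3 : measurable A3 by exact: measurable_old_present.
have sub : {ae P, forall w, [set w | (x < sojourn Q 0 w)%R] w ->
                            (A0 `|` A1 `|` A2 `|` A3) w}.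
  move: taus validQ wcQ; apply: filterS3 => w /arrival_homo Tle sp wc /= xV.
  have [A3w|A3w] := pselect (A3 w); [by right|left].
  have [A2w|A2w] := pselect (A2 w); [by right|left].
  move: A2w => /negP; rewrite -ltNge => xJ.
  have ex : exists k : nat, x < arrival Q k%:Z w by exists J.
  have := ex_minnP ex => -[[|M] xM kmin].
    by move: xM; rewrite arrival0 ltNge x0.
  have MJ : (M < J)%N by exact: kmin.
  have Mx : arrival Q M%:Z w <= x.
    by rewrite leNgt; apply/negP => /kmin; rewrite ltnn.
  have := @sojourn_work_le _ _ _ _ _ sp Tle N K M x wc (arrival0 Q w).
  rewrite x0 xV => /(_ isT xM (not_old_present A3w)) [[n nN xB]|xB].
    left; rewrite /A0 -(bigcup_mkord _ (fun n => \big[setU/set0]_(M < J) E n 0%N M)).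
    exists n => //; rewrite -(bigcup_mkord _ (E n 0%N)); exists M => //.
    by split => //; rewrite addn0.
  by right; rewrite /A1 -(bigcup_mkord _ (E N K)); exists M.
have PE n j M : (P (E n j M) <= (a * m ^+ j.+1 * q ^+ n * q ^+ M)%:E)%E.
  exact: backlog_le.
have mV : measurable [set w | (x < sojourn Q 0 w)%R].
  exact: measurable_lt_set.
apply: (le_trans (ae_le_measure mV _ sub)).
  by do 3 (apply: measurableU => //).
apply: (le_trans (measureU2 _ _ _)) => //; first by do 2 (apply: measurableU => //).
apply: (le_trans (leeD2r _ (measureU2 _ _ _))) => //; first exact: measurableU.
apply: (le_trans (leeD2r _ (leeD2r _ (measureU2 _ _ _)))) => //.
have PA0 : (P A0 <= (a * (m * (1 - q)^-1 * (1 - q)^-1))%:E)%E.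
  have Pn n : (P (\big[setU/set0]_(M < J) E n 0%N M) <=
      (a * m * q ^+ n * (1 - q)^-1)%:E)%E.
    apply: (le_trans (Boole_le J (mE n 0%N) (PE n 0%N))).
    rewrite lee_fin -mulr_sumr expr1 ler_wpM2l ?sum_geometric_le//.
    by rewrite !mulr_ge0// ?exprn_ge0// ltW.
  have mAn n : measurable (\big[setU/set0]_(M < J) E n 0%N M).
    by apply: bigsetU_measurable => ? _.
  apply: (le_trans (Boole_le N mAn Pn)).
  rewrite lee_fin -mulr_suml -mulr_sumr !mulrA.
  apply: ler_wpM2r; first by rewrite invr_ge0 ltW.
  by rewrite ler_wpM2l ?sum_geometric_le// mulr_ge0// ltW.
have PA1 : (P A1 <= e3%:E)%E.
  apply: (le_trans (Boole_le J (mE N K) (PE N K))).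
  rewrite lee_fin -mulr_sumr; apply: le_trans PN.
  rewrite [leRHS]mulrAC ler_wpM2l ?sum_geometric_le//.
  by rewrite !mulr_ge0// ?exprn_ge0// ltW.
have PA2 : (P A2 <= e3%:E)%E.
  apply: (le_trans (arrivals_before_le J x lambda0 indepQ expo s0)).
  by rewrite lee_fin.
have PA3 : (P A3 <= e3%:E)%E by rewrite /A3 old_present_prob.
have -> : e = e3 + e3 + e3 by rewrite /e3; lra.
rewrite -addrA -addrA -EFinD (mulrC _ a) !EFinD !addeA.
by do 3 (apply: leeD => //).
Qed.

(** * The lower bound for FB *)

Lemma le_integral_ge0 d (T : measurableType d) (R : realType)
    (mu : {measure set T -> \bar R}) (D : set T) (f g : T -> \bar R) :
  measurable D -> measurable_fun D f -> measurable_fun D g ->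
  (forall x, D x -> 0 <= g x)%E -> (forall x, D x -> f x <= g x)%E ->
  (\int[mu]_(x in D) f x <= \int[mu]_(x in D) g x)%E.
Proof.
move=> mD mf mg g0 fg; rewrite integralE.
apply: (@le_trans _ _ (\int[mu]_(x in D) f^\+ x)%E).
  by rewrite geeDl// leeNl oppe0; exact: integral_ge0.
apply: ge0_le_integral => //; first exact: measurable_funepos.
by move=> x Dx; rewrite funeposE ge_max fg//= g0.
Qed.

(** The integrand is the derivative in t of - exp (al + be t) sin (om (u - t)). It describes the
    wave while the workload u drains at unit rate. *)
Lemma expR_sin_integral (R : realType) (al be om u m : R) : 0 < m ->
  (\int[lebesgue_measure]_(t in `[0%R, m])
     (expR (al + be * t) * (om * cos (om * (u - t)) - be * sin (om * (u - t))))%:E =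
   (expR al * sin (om * u) - expR (al + be * m) * sin (om * (u - m)))%:E)%E.
Proof.
move=> m0.
pose l1 : R^o -> R^o := cst al + be \*: id.
pose l2 : R^o -> R^o := om \*: (cst u - id).
pose F : R^o -> R^o := - ((expR \o l1) * (sin \o l2)).
pose f t := expR (al + be * t) * (om * cos (om * (u - t)) - be * sin (om * (u - t))).
have dF (t : R^o) : is_derive t (1 : R^o) F (f t).
  have d1 : is_derive t (1 : R^o) l1 be.
    by apply: is_derive_eq; rewrite add0r /GRing.scale/= mulr1.
  have d2 : is_derive t (1 : R^o) l2 (- om).
    by apply: is_derive_eq; rewrite sub0r /GRing.scale/= mulrN1.
  have d3 := is_derive1_comp (is_derive_expR (l1 t)) d1.
  have d4 := is_derive1_comp (is_derive_sin (l2 t)) d2.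
  apply: is_derive_eq.
  change (- (expR (al + be * t) * (cos (om * (u - t)) * - om) +
    sin (om * (u - t)) * (expR (al + be * t) * be)) = f t).
  by rewrite /f; ring.
have cF : continuous F.
  by move=> t; apply: differentiable_continuous; apply/derivable1_diffP; exact: ex_derive.
have cl (a c : R) : continuous (fun t : R => a + c * t).
  move=> t; apply: cvgD; first exact: cvg_cst.
  by apply: cvgM; [exact: cvg_cst|exact: cvg_id].
have cm : continuous (fun t : R => om * (u - t)).
  rewrite (_ : (fun t : R => om * (u - t)) = fun t => om * u + (- om) * t)//.
  by apply/funext => t; ring.
have cf : continuous f.
  move=> t; apply: cvgM.
    exact: (continuous_comp (@cl al be t) (@continuous_expR R _)).
  apply: cvgB; apply: cvgM; try exact: cvg_cst.
    exact: (continuous_comp (@cm t) (@continuous_cos R _)).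
  exact: (continuous_comp (@cm t) (@continuous_sin R _)).
rewrite (@continuous_FTC2 _ f F)//.
- rewrite -EFinB; congr _%:E.
  change (- (expR (al + be * m) * sin (om * (u - m))) -
    - (expR (al + be * 0) * sin (om * (u - 0))) =
    expR al * sin (om * u) - expR (al + be * m) * sin (om * (u - m))).
  by rewrite mulr0 addr0 subr0 opprK addrC.
- exact: continuous_subspaceT.
- split.
  + by move=> t _; exact: ex_derive.
  + by apply: cvg_at_right_filter; exact: cF.
  + by apply: cvg_at_left_filter; exact: cF.
- by move=> t _; rewrite derive1E; apply: derive_val.
Qed.

Lemma le_cst_integrable d (T : measurableType d) (R : realType)
    (mu : probability T R) (f : T -> R) (M : R) :
  measurable_fun setT f -> (forall x, `|f x| <= M) ->
  mu.-integrable setT (EFin \o f).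
Proof.
move=> mf fM.
apply: (le_integrable _ _ _ (finite_measure_integrable_cst mu M measurableT)) => //.
  exact/measurable_EFinP.
by move=> x _ /=; rewrite lee_fin (le_trans (fM x))// ler_norm.
Qed.

Lemma clip_ge0 (R : realType) (b x : R) : 0 <= clip b x.
Proof. by rewrite /clip le_max lexx. Qed.

Lemma clip_le (R : realType) (b x : R) : 0 <= b -> clip b x <= b.
Proof. by move=> b0; rewrite /clip ge_max b0/= ge_min lexx orbT. Qed.

Lemma measurable_clip (R : realType) (b : R) : measurable_fun setT (clip b).
Proof. by apply: measurable_maxr => //; apply: measurable_minr. Qed.

(** * The truncated wave as a subsolution *)

Section bump.
Context (R : realType) (nu : probability R R) (lambda theta omega b : R).
Hypotheses (lambda_gt0 : 0 < lambda) (theta_ge0 : 0 <= theta)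
  (omega_gt0 : 0 < omega) (b_ge0 : 0 <= b) (omega_b : omega * b <= 1).

(* Real and imaginary part of E exp ((theta + i omega) clip b B). Under
   [resonance] the Laplace exponent z - lambda (E exp (z clip b B) - 1) of the
   workload at z = theta + i omega is the real number [bump_rate]. *)
Definition cos_mgf : R :=
  \int[nu]_x (expR (theta * clip b x) * cos (omega * clip b x)).
Definition sin_mgf : R :=
  \int[nu]_x (expR (theta * clip b x) * sin (omega * clip b x)).

Hypothesis resonance : lambda * sin_mgf = omega.

Definition bump_rate : R := theta - lambda * (cos_mgf - 1).

Definition wave (u : R) : R := expR (theta * u) * sin (omega * u).
Definition bump (u : R) : R := if 0 < u < pi / omega then wave u else 0.
Definition bump_max : R := expR (theta * (pi / omega)).

Let K_gt0 : 0 < pi / omega. Proof. by rewrite divr_gt0// pi_gt0. Qed.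

Lemma bump_ge0 u : 0 <= bump u.
Proof.
rewrite /bump; case: ifP => // /andP[u0]; rewrite ltr_pdivlMr// => uK.
by rewrite mulr_ge0 ?expR_ge0// sin_ge0_pi// mulr_ge0 ?ltW//= mulrC.
Qed.

Lemma wave_le_max u : u <= pi / omega -> wave u <= bump_max.
Proof.
move=> uK; apply: (@le_trans _ _ (expR (theta * u) * 1)).
  by rewrite ler_wpM2l ?expR_ge0// sin_le1.
by rewrite mulr1 ler_expR ler_wpM2l.
Qed.

Lemma bump_le_max u : bump u <= bump_max.
Proof.
rewrite /bump; case: ifP => [/andP[_ /ltW]|_]; first exact: wave_le_max.
exact: expR_ge0.
Qed.

Lemma measurable_wave : measurable_fun setT wave.
Proof.
apply: measurable_funM.
  by apply: measurableT_comp => //; exact: measurable_funM.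
apply: (measurableT_comp (f := @sin R)); last exact: measurable_funM.
by apply: continuous_measurable_fun; exact: continuous_sin.
Qed.

Lemma measurable_bump : measurable_fun setT bump.
Proof.
apply: measurable_fun_ifT => //; last exact: measurable_wave.
by apply: measurable_and; apply: measurable_fun_ltr.
Qed.

(* A jump of size at most b <= pi / omega overshoots [0, pi / omega] by at most
   one half-period, where the wave is negative. *)
Lemma wave_le_bump u : 0 <= u <= 2 * (pi / omega) -> wave u <= bump u.
Proof.
move=> /andP[u0 uK]; rewrite /bump; case: ifPn => //.
move: u0; rewrite le_eqVlt => /predU1P[<- _|u0].
  by rewrite /wave !mulr0 sin0 mulr0.
rewrite u0/= -leNgt => Ku.
rewrite /wave mulr_ge0_le0 ?expR_ge0// -[omega * u](subrK pi) sinDpi.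
rewrite oppr_le0 sin_ge0_pi// subr_ge0 lerBlDr.
move: Ku uK; rewrite mulrA ler_pdivrMr// ler_pdivlMr// mulrC => -> /=.
by rewrite mulrC => ?; lra.
Qed.

Lemma waveD v c : wave (v + c) = expR (theta * v) *
  (sin (omega * v) * (expR (theta * c) * cos (omega * c)) +
   cos (omega * v) * (expR (theta * c) * sin (omega * c))).
Proof. by rewrite /wave !mulrDr expRD sinD; ring. Qed.

Let mclip := @measurable_clip R b.

Let mexp : measurable_fun setT (fun x => expR (theta * clip b x)).
Proof. by apply: measurableT_comp => //; apply: measurable_funM. Qed.

Let mcosc : measurable_fun setT (fun x => cos (omega * clip b x)).
Proof.
apply: (measurableT_comp (f := @cos R)); last exact: measurable_funM.
by apply: continuous_measurable_fun; exact: continuous_cos.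
Qed.

Let msinc : measurable_fun setT (fun x => sin (omega * clip b x)).
Proof.
apply: (measurableT_comp (f := @sin R)); last exact: measurable_funM.
by apply: continuous_measurable_fun; exact: continuous_sin.
Qed.

Let exp_le x : expR (theta * clip b x) <= expR (theta * b).
Proof. by rewrite ler_expR ler_wpM2l// clip_le. Qed.

Lemma integrable_cos_mgf : nu.-integrable setT
  (EFin \o (fun x => expR (theta * clip b x) * cos (omega * clip b x))).
Proof.
apply: (@le_cst_integrable _ _ _ _ _ (expR (theta * b))).
  exact: measurable_funM.
move=> x; rewrite normrM -[leRHS]mulr1 ler_pM ?cos_max//.
by rewrite ger0_norm ?expR_ge0.
Qed.

Lemma integrable_sin_mgf : nu.-integrable setT
  (EFin \o (fun x => expR (theta * clip b x) * sin (omega * clip b x))).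
Proof.
apply: (@le_cst_integrable _ _ _ _ _ (expR (theta * b))).
  exact: measurable_funM.
move=> x; rewrite normrM -[leRHS]mulr1 ler_pM ?sin_max//.
by rewrite ger0_norm ?expR_ge0.
Qed.

(** The imaginary part of exp (z v) E exp (z clip b B), where [resonance] has replaced [sin_mgf] by
    omega / lambda and the definition of [bump_rate] has replaced [cos_mgf] by (lambda + theta -
    bump_rate) / lambda. *)
Definition wave_drift (v : R) : R := lambda^-1 * (expR (theta * v) *
  (omega * cos (omega * v) + (lambda + theta - bump_rate) * sin (omega * v))).

Lemma wave_integral v :
  (\int[nu]_x (wave (v + clip b x))%:E = (wave_drift v)%:E)%E.
Proof.
have l0 : lambda != 0 by rewrite gt_eqF.
under eq_integral do rewrite waveD.
have ic := integrable_cos_mgf; have is_ := integrable_sin_mgf.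
pose gc x := expR (theta * clip b x) * cos (omega * clip b x).
pose gs x := expR (theta * clip b x) * sin (omega * clip b x).
have iZ (k : R) g : nu.-integrable setT (EFin \o g) ->
    nu.-integrable setT (EFin \o (fun x => k * g x)).
  by move=> ig; have := integrableZl measurableT k ig.
have ii : nu.-integrable setT (EFin \o (fun x =>
    sin (omega * v) * gc x + cos (omega * v) * gs x)).
  exact: (integrableD measurableT (iZ _ _ ic) (iZ _ _ is_)).
rewrite -[LHS]fineK; last exact: integrable_fin_num (iZ _ _ ii).
congr _%:E.
rewrite -/(Rintegral _ _ _) RintegralZl// RintegralD//; [|exact: iZ|exact: iZ].
rewrite !RintegralZl// -/cos_mgf -/sin_mgf /wave_drift /bump_rate -resonance.
by field.
Qed.

Definition bump_mean (v : R) : \bar R := \int[nu]_x (bump (v + clip b x))%:E.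

Lemma wave_drift_le v : 0 <= v <= pi / omega -> ((wave_drift v)%:E <= bump_mean v)%E.
Proof.
move=> /andP[v0 vK]; rewrite -wave_integral; apply: le_integral_ge0 => //.
- apply/measurable_EFinP; apply: measurableT_comp; first exact: measurable_wave.
  exact: measurable_funD.
- apply/measurable_EFinP; apply: measurableT_comp; first exact: measurable_bump.
  exact: measurable_funD.
- by move=> x _; rewrite lee_fin bump_ge0.
- move=> x _; rewrite lee_fin wave_le_bump// addr_ge0 ?clip_ge0//=.
  rewrite mulrDl mul1r lerD// (le_trans (clip_le x b_ge0))//.
  rewrite ler_pdivlMr// mulrC (le_trans omega_b)// (le_trans _ (pi_ge2 R))//.
  by rewrite ler1n.
Qed.

Lemma bump_mean_ge0 v : (0 <= bump_mean v)%E.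
Proof. by apply: integral_ge0 => x _; rewrite lee_fin bump_ge0. Qed.

Lemma measurable_bump_mean : measurable_fun setT bump_mean.
Proof.
apply: (@measurable_fun_fubini_tonelli_F _ _ _ _ _ nu
  (fun z : R * R => (bump (z.1 + clip b z.2))%:E)).
  apply/measurable_EFinP; apply: measurableT_comp; first exact: measurable_bump.
  by apply: measurable_funD => //; apply: measurableT_comp.
by move=> z; rewrite lee_fin bump_ge0.
Qed.

(* The workload is u and the time left is y > 0: if the next arrival at t comes
   first the value of the workload after it is collected, if the workload survives
   until y the maximal value is. *)
Definition reward (u y t : R) : \bar R :=
  if (0 <= t) && (t < y) && (t < u) then
    (bump_mean (u - t) * (expR (- (bump_rate * (y - t))))%:E)%E
  else if (y <= t) && (y < u) then bump_max%:E else 0%E.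

Lemma reward_ge0 u y t : (0 <= reward u y t)%E.
Proof.
rewrite /reward; case: ifP => _.
  by rewrite mule_ge0 ?bump_mean_ge0// lee_fin expR_ge0.
by case: ifP => // _; rewrite lee_fin expR_ge0.
Qed.

Lemma measurable_reward d (T : measurableType d) (u y t : T -> R) :
  measurable_fun setT u -> measurable_fun setT y -> measurable_fun setT t ->
  measurable_fun setT (fun w => reward (u w) (y w) (t w)).
Proof.
move=> mu my mt; apply: measurable_fun_ifT.
- apply: measurable_and; last exact: measurable_fun_ltr.
  by apply: measurable_and; [exact: measurable_fun_ler|exact: measurable_fun_ltr].
- apply: emeasurable_funM.
    apply: measurableT_comp; first exact: measurable_bump_mean.
    exact: measurable_funB.
  apply/measurable_EFinP; apply: measurableT_comp => //.
  apply: measurableT_comp => //; apply: measurable_funM => //.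
  exact: measurable_funB.
- apply: measurable_fun_ifT => //.
  by apply: measurable_and; [exact: measurable_fun_ler|exact: measurable_fun_ltr].
Qed.

Context d (Om : measurableType d) (P : probability Om R) (tau : {RV P >-> R}).
Hypothesis expo : forall A : set R, measurable A ->
  distribution P tau A = exponential_prob lambda A.
Local Notation mu := lebesgue_measure.

Let mpdf : measurable_fun setT (fun x => (exponential_pdf lambda x)%:E).
Proof. by apply/measurable_EFinP; exact: measurable_exponential_pdf. Qed.

Let pdf_ge0 x : 0 <= exponential_pdf lambda x.
Proof. by rewrite exponential_pdf_ge0// ltW. Qed.

Lemma exponential_tail y : 0 <= y ->
  (\int[mu]_(x in `[y, +oo[) (exponential_pdf lambda x)%:E =
   (expR (- (lambda * y)))%:E)%E.
Proof.
move=> y0.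
have cF : continuous (fun x : R => expR (- lambda * x)).
  move=> z; apply: continuous_comp; last exact: continuous_expR.
  by apply: cvgM; [exact: cvg_cst|exact: cvg_id].
rewrite (@ge0_continuous_FTC2y _ _ (fun x => - (expR (- lambda * x))) _ 0)//.
- by rewrite EFinN oppeK add0e mulNr.
- apply: continuous_subspaceW (@within_continuous_exponential_pdf R lambda).
  by move=> x /=; rewrite !in_itv/= !andbT; exact: le_trans.
- rewrite -oppr0; apply: cvgN.
  rewrite (_ : (fun x => expR (- lambda * x)) =
               (fun z => expR (- z)) \o (fun z => lambda * z)); last first.
    by apply: eq_fun => x; rewrite mulNr.
  apply: (@cvg_comp _ _ _ _ _ _ (pinfty_nbhs R)); last exact: cvgr_expR.
  exact: gt0_cvgMry.
- by apply: cvgN; apply/cvg_at_right_filter; exact: cF.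
- move=> x; rewrite in_itv/= andbT => yx; apply: derive1_exponential_pdf.
  by rewrite in_itv/= andbT (le_lt_trans y0).
Qed.

(** The exponentials from [wave_drift], the remaining time and the interarrival density multiply to
    exp (al + be t) with be = bump_rate - lambda - theta, so the drift of the wave becomes the
    integrand of [expR_sin_integral]. The bound m is either u or y, whichever comes first. *)
Let step_before u y m : 0 < m -> m <= u -> m <= y -> u <= pi / omega ->
  ((expR (theta * u - bump_rate * y) * sin (omega * u) -
    expR (theta * u - bump_rate * y + (bump_rate - lambda - theta) * m) *
    sin (omega * (u - m)))%:E <=
   \int[mu]_(t in `[0%R, m[) (reward u y t * (exponential_pdf lambda t)%:E))%E.
Proof.
move=> m0 mu_ my uK; rewrite -expR_sin_integral//.
have mg : measurable_fun setT (fun t : R =>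
   (expR (theta * u - bump_rate * y + (bump_rate - lambda - theta) * t) *
     (omega * cos (omega * (u - t)) -
      (bump_rate - lambda - theta) * sin (omega * (u - t))))%:E).
  apply/measurable_EFinP; apply: measurable_funM.
    by apply: measurableT_comp => //; apply: measurable_funD.
  have ml : measurable_fun setT (fun t : R => omega * (u - t)).
    by apply: measurable_funM => //; exact: measurable_funB.
  apply: measurable_funB; apply: measurable_funM => //.
    apply: (measurableT_comp (f := @cos R)) => //.
    by apply: continuous_measurable_fun; exact: continuous_cos.
  apply: (measurableT_comp (f := @sin R)) => //.
  by apply: continuous_measurable_fun; exact: continuous_sin.
rewrite -integral_itv_bndo_bndc; last exact: measurable_funTS.
have mr : measurable_fun setT (fun t => reward u y t * (exponential_pdf lambda t)%:E)%E.
  by apply: emeasurable_funM => //; exact: measurable_reward.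
apply: le_integral_ge0 => //.
- exact: measurable_funTS.
- exact: measurable_funTS.
- by move=> t _; rewrite mule_ge0 ?reward_ge0// lee_fin.
- move=> t /=; rewrite in_itv/= => /andP[t0 tm].
  have tu := lt_le_trans tm mu_; have ty := lt_le_trans tm my.
  rewrite /reward t0 tu ty/= exponential_pdfE//.
  apply: (@le_trans _ _ ((wave_drift (u - t))%:E *
    (expR (- (bump_rate * (y - t))))%:E * (lambda * expR (- lambda * t))%:E)%E).
    rewrite -!EFinM lee_fin /wave_drift le_eqVlt; apply/orP; left; apply/eqP.
    rewrite (_ : theta * u - bump_rate * y + (bump_rate - lambda - theta) * t =
      theta * (u - t) + (- (bump_rate * (y - t))) + (- lambda * t)); last by ring.
    by rewrite !expRD; field; rewrite gt_eqF.
  apply: lee_wpmul2r; first by rewrite lee_fin mulr_ge0 ?expR_ge0// ltW.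
  apply: lee_wpmul2r; first by rewrite lee_fin expR_ge0.
  apply: wave_drift_le; rewrite subr_ge0 ltW//= (le_trans _ uK)//.
  by rewrite lerBlDr lerDl.
Qed.

(** If u <= y the workload empties first, and the boundary term at m = u vanishes with the sine. If
    y < u, the boundary term at m = y is at most [bump_max] times the probability exp (- lambda y)
    of no arrival before y, which is what the second branch of [reward] collects. *)
Lemma bump_step u y : 0 < y ->
  ((bump u * expR (- (bump_rate * y)))%:E <=
   \int[distribution P tau]_t reward u y t)%E.
Proof.
move=> y0; rewrite /bump; case: ifPn => [/andP[u0 uK]|_]; last first.
  by rewrite mul0r; apply: integral_ge0 => t _; exact: reward_ge0.
have mru : measurable_fun setT (reward u y) by exact: measurable_reward.
rewrite (exponential_integral expo mru (reward_ge0 u y)).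
have mr : measurable_fun setT (fun t => reward u y t * (exponential_pdf lambda t)%:E)%E.
  exact: emeasurable_funM.
have r0 t : (0 <= reward u y t * (exponential_pdf lambda t)%:E)%E.
  by rewrite mule_ge0 ?reward_ge0// lee_fin.
have waveE : wave u * expR (- (bump_rate * y)) =
    expR (theta * u - bump_rate * y) * sin (omega * u).
  by rewrite /wave mulrAC -expRD.
rewrite waveE; have [uy|yu] := leP u y.
  apply: (@le_trans _ _ (\int[mu]_(t in `[0%R, u[)
      (reward u y t * (exponential_pdf lambda t)%:E))%E).
    have := step_before u0 (lexx u) uy (ltW uK).
    by rewrite subrr mulr0 sin0 mulr0 subr0.
  by apply: ge0_subset_integral => //.
apply: (@le_trans _ _ (\int[mu]_(t in `[0%R, y[ `|` `[y, +oo[)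
    (reward u y t * (exponential_pdf lambda t)%:E))%E); last first.
  by apply: ge0_subset_integral => //; exact: measurableU.
rewrite ge0_integral_setU//=; last 2 first.
- exact: measurable_funTS.
- apply/disj_setPS => t [] /=; rewrite !in_itv/= andbT => /andP[_ ty].
  by rewrite leNgt ty.
have tailE : (\int[mu]_(t in `[y, +oo[) (reward u y t * (exponential_pdf lambda t)%:E) =
    (bump_max * expR (- (lambda * y)))%:E)%E.
  under eq_integral => t.
    rewrite inE/= in_itv/= andbT => yt.
    rewrite /reward (ltNge t y) yt andbF/= yu.
    over.
  rewrite ge0_integralZl//; last 3 first.
  - exact: measurable_funTS.
  - by move=> t _; rewrite lee_fin.
  - by rewrite lee_fin expR_ge0.
  by rewrite exponential_tail ?ltW.
rewrite [X in (_ <= _ + X)%E]tailE -leeBlDr//.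
apply: le_trans (step_before y0 (ltW yu) (lexx y) (ltW uK)).
rewrite -EFinB lee_fin lerD2l lerN2.
rewrite (_ : theta * u - bump_rate * y + (bump_rate - lambda - theta) * y =
  theta * (u - y) + - (lambda * y)); last by ring.
rewrite expRD mulrAC ler_wpM2r ?expR_ge0//.
by apply: wave_le_max; rewrite (le_trans _ (ltW uK))// lerBlDr lerDl ltW.
Qed.

End bump.

(** * The clipped busy period inside an FB sojourn *)

Section fb_lower_bound.
Context d (Om : measurableType d) (R : realType) (P : probability Om R).
Context (Q : queue P) (nu : probability R R) (lambda theta omega b : R).
Hypotheses (lambda_gt0 : 0 < lambda) (theta_ge0 : 0 <= theta)
  (omega_gt0 : 0 < omega) (b_gt0 : 0 < b) (omega_b : omega * b <= 1).
Hypothesis resonance : lambda * sin_mgf nu theta omega b = omega.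
Hypothesis indepQ : mutually_independent (queue_input Q).
Hypothesis expo : forall n (A : set R), measurable A ->
  distribution P (interarrival Q n) A = exponential_prob lambda A.
Hypothesis serviceE : forall n (A : set R), measurable A ->
  distribution P (service Q n) A = nu A.
Variable x : R.
Hypothesis x_gt0 : 0 < x.

Local Notation T n w := (arrival Q (Posz n) w).
Local Notation tau n w := (interarrival Q (Posz n) w).
Local Notation rate := (bump_rate nu lambda theta omega b).
Local Notation bmp := (bump theta omega).
Local Notation bmax := (bump_max theta omega).

(* [clipped_work n] is the workload just after T n in the busy period started by
   work b at time 0 when customer j > 0 brings clip b (B j); [alive n] says that
   this busy period has lasted until T n, and [crossing n] that it lasts beyond x,
   the customers n and n + 1 being the neighbours of x. *)
Definition clipped_work (n : nat) (w : Om) : R :=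
  b + \sum_(j < n) clip b (service Q (Posz j.+1) w) - T n w.

Fixpoint alive (n : nat) (w : Om) : bool :=
  if n is n'.+1 then
    alive n' w && ((0 <= tau n' w) && (tau n' w < clipped_work n' w))
  else b <= service Q 0 w.

(** The subsolution evaluated at arrival epochs and stopped at x. Its expectation drops from n to n
    + 1 by at most [bmax] times the probability of [crossing n]. *)
Definition value (n : nat) (w : Om) : R :=
  if alive n w && (T n w < x) then
    bmp (clipped_work n w) * expR (- (rate * (x - T n w)))
  else 0.

Definition crossing (n : nat) : set Om :=
  [set w | [&& alive n w, T n w < x, x <= T n.+1 w &
               x < T n w + clipped_work n w]].

Lemma arrival_succ n w : T n.+1 w = T n w + tau n w.
Proof. by rewrite /= big_ord_recr. Qed.

Lemma clipped_workS n w : clipped_work n.+1 w =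
  clipped_work n w - tau n w + clip b (service Q (Posz n.+1) w).
Proof. by rewrite /clipped_work arrival_succ big_ord_recr/=; ring. Qed.

Section measurability.
Variables (C : set (int + int)) (n : nat).
Hypothesis Ctau : forall i, (i < n)%N -> C (inl (Posz i)).
Hypothesis CB : forall i, (i <= n)%N -> C (inr (Posz i)).
Local Notation history := (g_sigma_algebraType (cylinder (queue_input Q) C)).

Let mtau i : (i < n)%N ->
  measurable_fun setT (interarrival Q (Posz i) : history -> R).
Proof. by move=> /Ctau Ci; exact: (@measurable_coordinate _ _ _ _ _ (queue_input Q) C (inl (Posz i)) Ci). Qed.

Let mB i : (i <= n)%N -> measurable_fun setT (service Q (Posz i) : history -> R).
Proof. by move=> /CB Ci; exact: (@measurable_coordinate _ _ _ _ _ (queue_input Q) C (inr (Posz i)) Ci). Qed.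

Let mT k : (k <= n)%N ->
  measurable_fun setT ((fun w => T k w) : history -> R).
Proof.
elim: k => [|k IH] kn.
  rewrite (_ : (fun w => _) = cst 0) ?measurable_cst//.
  by apply/funext => w; exact: arrival0.
rewrite (_ : (fun w => _) = fun w => T k w + tau k w); last first.
  by apply/funext => w; exact: arrival_succ.
by apply: measurable_funD; [apply: IH; exact: ltnW|exact: mtau].
Qed.

Let mW k : (k <= n)%N -> measurable_fun setT (clipped_work k : history -> R).
Proof.
elim: k => [|k IH] kn.
  rewrite (_ : clipped_work 0 = cst b)//; apply/funext => w.
  by rewrite /clipped_work !big_ord0 arrival0 addr0 subr0.
rewrite (_ : clipped_work k.+1 = fun w =>
  clipped_work k w - tau k w + clip b (service Q (Posz k.+1) w)); last first.
  by apply/funext => w; exact: clipped_workS.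
apply: measurable_funD.
  by apply: measurable_funB; [apply: IH; exact: ltnW|exact: mtau].
by apply: measurableT_comp; [exact: measurable_clip|exact: mB].
Qed.

Let malive k : (k <= n)%N -> measurable_fun setT (alive k : history -> bool).
Proof.
elim: k => [|k IH] kn /=.
  by apply: measurable_fun_ler => //; exact: mB.
apply: measurable_and; first by apply: IH; exact: ltnW.
apply: measurable_and; first by apply: measurable_fun_ler => //; exact: mtau.
by apply: measurable_fun_ltr; [exact: mtau|apply: mW; exact: ltnW].
Qed.

Lemma measurable_state : [/\ measurable_fun setT ((fun w => T n w) : history -> R),
  measurable_fun setT (clipped_work n : history -> R) &
  measurable_fun setT (alive n : history -> bool)].
Proof. by split; [exact: mT|exact: mW|exact: malive]. Qed.

End measurability.

Let mstate n : [/\ measurable_fun setT (fun w => T n w),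
  measurable_fun setT (clipped_work n) & measurable_fun setT (alive n)].
Proof.
have [] := @measurable_state setT n => // mT mW mA.
by split; [exact: measurable_fun_sigma_cylinder mT|
  exact: measurable_fun_sigma_cylinder mW|exact: measurable_fun_sigma_cylinder mA].
Qed.

Lemma measurable_value n : measurable_fun setT (value n).
Proof.
have [mT mW mA] := mstate n; apply: measurable_fun_ifT => //.
  by apply: measurable_and => //; exact: measurable_fun_ltr.
apply: measurable_funM.
  by apply: measurableT_comp => //; exact: measurable_bump.
apply: measurableT_comp => //; apply: measurableT_comp => //.
by apply: measurable_funM => //; exact: measurable_funB.
Qed.

Lemma measurable_crossing n : measurable (crossing n).
Proof.
have [mT mW mA] := mstate n; have [mT' _ _] := mstate n.+1.
have mc : measurable_fun setT (fun w => [&& alive n w, T n w < x, x <= T n.+1 w &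
               x < T n w + clipped_work n w]).
  apply: measurable_and => //; apply: measurable_and; first exact: measurable_fun_ltr.
  apply: measurable_and; first exact: measurable_fun_ler.
  by apply: measurable_fun_ltr => //; exact: measurable_funD.
by have := mc measurableT [set true]; rewrite setTI; exact.
Qed.

Lemma value_ge0 n w : 0 <= value n w.
Proof. by rewrite /value; case: ifP => // _; rewrite mulr_ge0 ?bump_ge0 ?expR_ge0. Qed.

(** For m = n these inputs fix the state just after arrival n and leave tau n independent of it; for
    m = n + 1 they include tau n and leave the service time of n + 1 independent. *)
Let past (m n : nat) : set (int + int) :=
  [set i | match i with inl k => k < m%:Z | inr k => k <= n%:Z end].

(** Freezing is applied twice: averaging over the service time of n + 1 turns [value n.+1] into
    [bump_mean], and averaging over tau n turns the whole right-hand side into the mean of [reward],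
    to which [bump_step] applies. *)
Lemma value_step n :
  (\int[P]_w (value n w)%:E <=
   \int[P]_w (value n.+1 w)%:E + bmax%:E * P (crossing n))%E.
Proof.
pose served w := alive n w && ((0 <= tau n w) && (tau n w < clipped_work n w)).
pose a w := if served w && (T n.+1 w < x) then expR (- (rate * (x - T n.+1 w))) else 0.
pose v w := clipped_work n w - tau n w.
pose F (z : (R * R) * R) := (`|z.1.1| * bmp (z.1.2 + clip b z.2))%:E.
pose a0 w : R := if alive n w && (T n w < x) then 1 else 0.
pose y w := x - T n w.
pose G (z : (R * R * R) * R) :=
  (`|z.1.1.1|%:E * reward nu lambda theta omega b z.1.1.2 z.1.2 z.2)%E.
have [mT mW mA] := mstate n; have [mT' _ _] := mstate n.+1.
have mF : measurable_fun [set: (R * R) * R] F.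
  apply/measurable_EFinP; apply: measurable_funM.
    by apply: measurableT_comp => //; apply: measurableT_comp.
  apply: measurableT_comp; first exact: measurable_bump.
  apply: measurable_funD; first exact: measurableT_comp.
  by apply: measurableT_comp => //; exact: measurable_clip.
have F0 z : (0 <= F z)%E by rewrite lee_fin mulr_ge0// bump_ge0.
have mG : measurable_fun [set: (R * R * R) * R] G.
  apply: emeasurable_funM.
    apply/measurable_EFinP; apply: measurableT_comp => //.
    by do 2 (apply: measurableT_comp => //).
  apply: measurable_reward => //; last exact: measurableT_comp.
  by do 2 (apply: measurableT_comp => //).
have G0 z : (0 <= G z)%E.
  by rewrite mule_ge0 ?lee_fin// reward_ge0// ltW.
have valueS w : (value n.+1 w)%:E = F (a w, v w, service Q (Posz n.+1) w).
  rewrite /F /= /value /a -/(served w) clipped_workS; case: ifP => _.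
    by rewrite ger0_norm ?expR_ge0// mulrC.
  by rewrite normr0 mul0r.
have mYa : measurable_fun setT ((fun w => (a w, v w)) :
    g_sigma_algebraType (cylinder (queue_input Q) (past n.+1 n)) -> R * R).
  have [//|//|mT1 mW1 mA1] := @measurable_state (past n.+1 n) n.
    by move=> i ni; rewrite /past/=; lia.
  have mtau : measurable_fun setT ((fun w => tau n w) :
      g_sigma_algebraType (cylinder (queue_input Q) (past n.+1 n)) -> R).
    by apply: (@measurable_coordinate _ _ _ _ _ (queue_input Q) _ (inl (Posz n))); rewrite /past/=; lia.
  have mTS : measurable_fun setT ((fun w => T n.+1 w) :
      g_sigma_algebraType (cylinder (queue_input Q) (past n.+1 n)) -> R).
    rewrite (_ : (fun w => _) = fun w => T n w + tau n w); last first.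
      by apply/funext => w; exact: arrival_succ.
    exact: measurable_funD.
  apply: measurable_fun_pair; last exact: measurable_funB.
  apply: measurable_fun_ifT => //.
    apply: measurable_and; last exact: measurable_fun_ltr.
    apply: measurable_and => //.
    by apply: measurable_and; [exact: measurable_fun_ler|exact: measurable_fun_ltr].
  apply: measurableT_comp => //; apply: measurableT_comp => //.
  by apply: measurable_funM => //; exact: measurable_funB.
have mYb : measurable_fun setT ((fun w => (a0 w, clipped_work n w, y w)) :
    g_sigma_algebraType (cylinder (queue_input Q) (past n n)) -> R * R * R).
  have [//|//|mT1 mW1 mA1] := @measurable_state (past n n) n.
  apply: measurable_fun_pair; last exact: measurable_funB.
  apply: measurable_fun_pair => //.
  apply: measurable_fun_ifT => //.
  by apply: measurable_and => //; exact: measurable_fun_ltr.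
have nB : ~ past n.+1 n (inr (Posz n.+1)) by rewrite /past/=; lia.
have ntau : ~ past n n (inl (Posz n)) by rewrite /past/=; lia.
have mean_ge0 := @bump_mean_ge0 R nu theta omega b omega_gt0.
have mean : (\int[P]_w (value n.+1 w)%:E =
    \int[P]_w ((`|a w|)%:E * bump_mean nu theta omega b (v w)))%E.
  under eq_integral do rewrite valueS.
  rewrite (indep_integral indepQ nB mYa mF F0); apply: eq_integral => w _.
  rewrite /F/=; under eq_integral do rewrite EFinM.
  rewrite ge0_integralZl//; last 2 first.
  - apply/measurable_EFinP; apply: measurableT_comp; first exact: measurable_bump.
    by apply: measurable_funD => //; exact: measurable_clip.
  - by move=> z _; rewrite lee_fin bump_ge0.
  by congr (_ * _)%E; apply: eq_measure_integral => A mA' _; exact: serviceE.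
(* In absolute time the first branch of [reward] is survival until an arrival before x and the
   second is [crossing n]. *)
have GE w : G (a0 w, clipped_work n w, y w, tau n w) =
    ((`|a w|)%:E * bump_mean nu theta omega b (v w) +
     bmax%:E * (\1_(crossing n) w)%:E)%E.
  have cE : (w \in crossing n) = [&& alive n w, T n w < x, x <= T n.+1 w &
       x < T n w + clipped_work n w] by apply/idP/idP; rewrite inE.
  rewrite /G/= indicE cE /a0 /a /served /reward /y arrival_succ ltrBrDl lerBlDl ltrBlDl.
  case: (alive n w) => /=; last by rewrite normr0 !mul0e mule0 adde0.
  have [Tx|xT] := ltP (T n w) x => /=.
    rewrite normr1 mul1e; case: (leP 0 (tau n w)) => t0 /=.
      have [tx|xt] := ltP (T n w + tau n w) x => /=.
        rewrite mule0 adde0 andbT; case: ifP => _; last by rewrite normr0 mul0e.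
        by rewrite ger0_norm ?expR_ge0// muleC opprD addrA.
      by rewrite andbF normr0 mul0e add0e; case: ifP; rewrite ?mule1 ?mule0.
    rewrite normr0 mul0e add0e.
    by case: ifP; rewrite ?mule1 ?mule0.
  rewrite normr0 mul0e mule0 adde0; case: ifP => [|_]; last by rewrite normr0 mul0e.
  by move=> /andP[/andP[t0 _]]; rewrite ltNge (le_trans xT)// lerDl.
rewrite mean -[X in (bmax%:E * P X)%E]setIT -integral_indic//; last exact: measurable_crossing.
rewrite -ge0_integralZl//; last 2 first.
- by apply/measurable_EFinP; apply: measurable_indic; exact: measurable_crossing.
- by rewrite lee_fin expR_ge0.
rewrite -ge0_integralD//; last 4 first.
- by move=> w _; rewrite mule_ge0.
- have mY := measurable_fun_sigma_cylinder mYa.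
  apply: emeasurable_funM.
    apply/measurable_EFinP; apply: measurableT_comp => //.
    exact: (measurableT_comp measurable_fst mY).
  apply: measurableT_comp; first exact: measurable_bump_mean.
  exact: (measurableT_comp measurable_snd mY).
- by move=> w _; rewrite mule_ge0// lee_fin ?expR_ge0.
- apply: emeasurable_funM => //.
  by apply/measurable_EFinP; apply: measurable_indic; exact: measurable_crossing.
under eq_integral do rewrite -GE.
rewrite (indep_integral indepQ ntau mYb mG G0).
apply: ge0_le_integral => //.
- by move=> w _; rewrite lee_fin value_ge0.
- by apply/measurable_EFinP; exact: measurable_value.
- have mY := measurable_fun_sigma_cylinder mYb.
  have mGF := @measurable_fun_fubini_tonelli_F _ _ _ _ R
    (distribution P (queue_input Q (inl (Posz n)))) G mG G0.
  exact: (measurableT_comp mGF mY).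
move=> w _; rewrite /G/=.
rewrite /value /a0; case: ifP => [/andP[aw Tx]|_]; last first.
  by apply: integral_ge0 => t _; rewrite mule_ge0 ?lee_fin// reward_ge0// ltW.
rewrite normr1; under eq_integral do rewrite mul1e.
apply: (bump_step lambda_gt0 theta_ge0 omega_gt0 (ltW b_gt0) omega_b resonance
  (@expo (Posz n))).
by rewrite /y subr_gt0.
Qed.

Lemma alive_tau_ge0 n i w : (i < n)%N -> alive n w -> 0 <= tau i w < clipped_work i w.
Proof.
elim: n => // n IH; rewrite ltnS leq_eqVlt => /predU1P[->|/IH H] /= /andP[an] //.
by move=> _; exact: H.
Qed.

Lemma alive_service n w : alive n w -> b <= service Q 0 w.
Proof. by elim: n => //= n IH /andP[/IH]. Qed.

Lemma alive_arrival n i j w : (i <= j <= n)%N -> alive n w -> T i w <= T j w.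
Proof.
move=> /andP[ij jn] an; elim: j ij jn => [|j IH].
  by rewrite leqn0 => /eqP ->.
rewrite leq_eqVlt => /predU1P[->//|]; rewrite ltnS => ij jn.
rewrite arrival_succ (le_trans (IH ij (ltnW jn)))// lerDl.
by have /andP[] := alive_tau_ge0 jn an.
Qed.

(** If customer 0 left by x, let j <= n be the last arrival before its departure; [fb_sojourn_ge]
    puts T j + clipped_work j at or before V 0. For j = n this contradicts survival beyond x. For j
    < n, [alive] puts T (j + 1) strictly before V 0, against the choice of j. *)
Lemma crossing_sojourn n w :
  (forall k : int, 0 <= interarrival Q k w) ->
  service_path (arrival Q ^~ w) (service Q ^~ w) (sojourn Q ^~ w)
      (service_rate Q w) ->
  fb_path (arrival Q ^~ w) (sojourn Q ^~ w) (service_rate Q w) ->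
  crossing n w -> x < sojourn Q 0 w.
Proof.
move=> /arrival_homo Tle sp fb /and4P[an Tx xT xW].
rewrite ltNge; apply/negP => Vx.
have bB : 0 < b <= service Q 0 w by rewrite b_gt0 (alive_service an).
have V0 : 0 < sojourn Q 0 w.
  rewrite lt_neqAle (path_sojourn_ge0 sp 0) andbT; apply/eqP => V0.
  have : service Q 0 w <= 0.
    rewrite -(path_served sp 0) -V0 addr0 -lee_fin (attainedE sp).
    by apply: (le_trans (served_le sp _ (lexx _))); rewrite subrr.
  by apply/negP; rewrite -ltNge; case/andP: bB; exact: lt_le_trans.
have ex : exists j : nat, sojourn Q 0 w <= T j w.
  by exists n.+1; rewrite (le_trans Vx).
have := ex_minnP ex => -[[|j] Vj jmin].
  by move: Vj; rewrite arrival0 leNgt V0.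
have jn : (j <= n)%N by rewrite -ltnS; apply: jmin; rewrite (le_trans Vx).
have TjV : T j w < sojourn Q 0 w.
  by rewrite ltNge; apply/negP => /jmin; rewrite ltnn.
have := fb_sojourn_ge sp fb Tle bB (arrival0 Q w) TjV.
have -> : b + \sum_(i < j) clip b (service Q i.+1%:Z w) = clipped_work j w + T j w.
  by rewrite /clipped_work subrK.
move=> WV; move: jn; rewrite leq_eqVlt => /predU1P[jE|jn].
  by move: xW; rewrite -jE addrC ltNge (le_trans WV).
have /andP[_ tauW] := alive_tau_ge0 jn an.
by move: Vj; rewrite leNgt arrival_succ addrC (lt_le_trans _ WV)// ltrD2r.
Qed.

(** On [crossing n] the point x lies in ]T n, T (n + 1)], and [alive] orders the epochs on every
    sample path. *)
Lemma trivIset_crossing : trivIset setT crossing.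
Proof.
suff disj n m w : (n < m)%N -> crossing n w -> crossing m w -> False.
  apply/trivIsetP => n m _ _ nm; apply/seteqP; split => // w [nw mw].
  by case: (ltngtP n m) nm => // H _; [exact: (disj n m w)|exact: (disj m n w)].
move=> nm /and4P[_ _ xT _] /and4P[am Tx _ _].
have : T n.+1 w <= T m w by apply: (alive_arrival _ am); rewrite nm leqnn.
by move=> /(le_trans xT); rewrite leNgt Tx.
Qed.

Hypothesis validQ : valid Q.
Hypothesis fbQ : foreground_background Q.

Lemma sum_crossing_le N :
  (\sum_(n < N) P (crossing n) <= P [set w | (x < sojourn Q 0 w)%R])%E.
Proof.
rewrite -measure_semi_additive_ord_I; last 3 first.
- by move=> n _; exact: measurable_crossing.
- by apply: sub_trivIset trivIset_crossing.
- by apply: bigsetU_measurable => n _; exact: measurable_crossing.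
apply: ae_le_measure.
- by apply: bigsetU_measurable => n _; exact: measurable_crossing.
- exact: measurable_lt_set.
move: (interarrival_ge0 expo) validQ fbQ; apply: filterS3 => w tau0 sp fb.
rewrite -bigcup_mkord => -[n _]; exact: crossing_sojourn.
Qed.

(** The telescoped form of [value_step]; since the crossings are disjoint and force x < V 0, their
    probabilities add up to at most the tail. *)
Lemma value_total N :
  (\int[P]_w (value 0 w)%:E <= \int[P]_w (value N w)%:E +
    bmax%:E * P [set w | (x < sojourn Q 0 w)%R])%E.
Proof.
apply: (@le_trans _ _ (\int[P]_w (value N w)%:E +
    bmax%:E * \sum_(n < N) P (crossing n))%E); last first.
  by rewrite leeD2l// lee_wpmul2l ?lee_fin ?expR_ge0// sum_crossing_le.
elim: N => [|N IH]; first by rewrite big_ord0 mule0 adde0.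
apply: (le_trans IH); rewrite big_ord_recr/= ge0_muleDr ?sume_ge0//.
rewrite [(_ * _ + _)%E in leRHS]addeC addeA leeD2r//.
exact: value_step.
Qed.

(** The remainder lives on T N <= x, where it is bounded, so it disappears as N grows. The norm of
    [rate] covers an exponent of either sign. *)
Lemma value_le N : (\int[P]_w (value N w)%:E <=
  (bmax * expR (`|rate| * x))%:E * P [set w | (T N w <= x)%R])%E.
Proof.
have mE : measurable [set w | (T N w <= x)%R].
  by apply: measurable_le_set => //; have [] := mstate N.
rewrite -[X in (_ * P X)%E]setIT -integral_indic// -ge0_integralZl//; last 2 first.
- by apply/measurable_EFinP; exact: measurable_indic.
- by rewrite lee_fin mulr_ge0 ?expR_ge0.
apply: ge0_le_integral => //.
- by move=> w _; rewrite lee_fin value_ge0.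
- by apply/measurable_EFinP; exact: measurable_value.
- by apply: emeasurable_funM => //; apply/measurable_EFinP; exact: measurable_indic.
move=> w _; rewrite lee_fin /value; case: ifP => [/andP[aN TN]|_]; last first.
  by rewrite mulr_ge0 ?mulr_ge0 ?expR_ge0.
have TNw : [set w | (T N w <= x)%R] w by exact: ltW.
rewrite indicE mem_set// mulr1.
apply: ler_pM; rewrite ?expR_ge0 ?bump_ge0 ?bump_le_max//.
rewrite ler_expR (le_trans (ler_norm _))// normrN normrM ler_wpM2l//.
rewrite ger0_norm; last by rewrite subr_ge0.
rewrite gerBl -(arrival0 Q w).
by apply: (@alive_arrival N 0 N) => //; rewrite leqnn.
Qed.

Lemma fb_sojourn_tail_ge :
  ((fine (nu `[b, +oo[%classic) * bmp b / bmax * expR (- (rate * x)))%:E <=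
   P [set w | (x < sojourn Q 0 w)%R])%E.
Proof.
have bmax0 : 0 < bmax by exact: expR_gt0.
rewrite -[X in (X * _)%R%:E]mulrC -mulrA EFinM lee_pdivrMl//.
have v0 : (\int[P]_w (value 0 w)%:E =
    (fine (nu `[b, +oo[%classic) * bmp b * expR (- (rate * x)))%:E)%E.
  have mE : measurable [set w | (b <= service Q 0 w)%R] by exact: measurable_le_set.
  have PE : P [set w | (b <= service Q 0 w)%R] = nu `[b, +oo[%classic.
    rewrite -(serviceE 0)//; congr (P _); apply/seteqP.
    by split => w /=; rewrite in_itv/= andbT.
  rewrite !EFinM fineK ?fin_num_measure// -PE -[X in P X]setIT -integral_indic//.
  rewrite -muleA muleC -ge0_integralZl//; last 2 first.
  - by apply/measurable_EFinP; exact: measurable_indic.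
  - by rewrite mule_ge0 ?lee_fin ?bump_ge0 ?expR_ge0.
  apply: eq_integral => w _; rewrite /value /clipped_work arrival0 x_gt0 big_ord0.
  rewrite addr0 !subr0 andbT indicE /=; case: ifP => bB.
    by rewrite mem_set// mule1.
  by rewrite memNset ?mule0//= bB.
rewrite -v0; apply/lee_addgt0Pr => e e0.
have as01 : 0 <= lambda / (lambda + 1) < 1.
  by rewrite divr_ge0 ?ltW ?addr_gt0//= ltr_pdivrMr ?addr_gt0// mul1r ltrDl.
have [N NP] := exists_geometric_le (bmax * expR (`|rate| * x) * expR (1 * x)) as01 e0.
apply: (le_trans (value_total N)); rewrite addeC leeD2l//.
apply: (le_trans (value_le N)).
have := arrivals_before_le N x lambda_gt0 indepQ expo ltr01.
move=> /(lee_wpmul2l _)/le_trans; apply; rewrite lee_fin.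
  by rewrite mulr_ge0 ?expR_ge0.
by rewrite mulrA.
Qed.

End fb_lower_bound.

(** * Choice of the exponents *)

Section trigonometric_bounds.
Context (R : realType).
Implicit Types t y : R.

Lemma pi_le4 : pi <= 4 :> R.
Proof.
have : pi / 2 <= 2 :> R.
  rewrite leNgt; apply/negP => lt2pi; have := @cos2_lt0 R.
  apply/negP; rewrite -leNgt ltW// cos_gt0_pihalf// lt2pi andbT.
  by rewrite (@lt_trans _ _ 0)// oppr_lt0 divr_gt0// pi_gt0.
by rewrite ler_pdivrMr// -natrM.
Qed.

(** Concavity of the sine: sin (t z) - t sin z has derivative t (cos (t z) - cos z), which is
    nonnegative because the cosine decreases on [0, pi]. *)
Lemma sin_scale_ge t y : 0 <= t <= 1 -> 0 <= y <= pi -> t * sin y <= sin (t * y).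
Proof.
move=> /andP[t0 t1] /andP[y0 ypi].
pose h : R^o -> R^o := (sin \o (t \*: id)) - (t \*: @sin R).
pose h' z := t * cos (t * z) - t * cos z.
have dh (z : R^o) : is_derive z (1 : R^o) h (h' z).
  have d2 : is_derive z (1 : R^o) (t \*: id : R^o -> R^o) t.
    by apply: is_derive_eq; rewrite /GRing.scale/= mulr1.
  have d4 := is_derive1_comp (is_derive_sin ((t \*: id : R^o -> R^o) z)) d2.
  apply: is_derive_eq.
  by rewrite /h' [t * cos (t * z)]mulrC.
have ch : continuous h.
  by move=> z; apply: differentiable_continuous; apply/derivable1_diffP; exact: ex_derive.
have : h 0 <= h y.
  apply: (@ger0_derive1_ndecr R h 0 pi) => //.
  - move=> z; rewrite in_itv/= => /andP[z0 zpi].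
    rewrite derive1E (@derive_val _ _ _ _ _ _ _ (dh z)) /h' -mulrBr mulr_ge0// subr_ge0.
    have tz : t * z <= z by rewrite ler_piMl// ltW.
    have m1 : t * z \in `[0, pi].
      by rewrite in_itv/= mulr_ge0 ?(ltW z0)//= (le_trans tz (ltW zpi)).
    have m2 : z \in `[0, pi] by rewrite in_itv/= !ltW.
    by rewrite leNgt ltr_cos// -leNgt.
  - exact: continuous_subspaceT.
have -> : h 0 = 0.
  by change (sin (t * 0) - t * sin 0 = 0 :> R); rewrite mulr0 sin0 mulr0 subr0.
by change (0 <= sin (t * y) - t * sin y -> t * sin y <= sin (t * y)); rewrite subr_ge0.
Qed.

Lemma sin_le y : 0 <= y -> sin y <= y.
Proof.
move=> y0; pose h : R^o -> R^o := id - @sin R.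
have dh (z : R^o) : is_derive z (1 : R^o) h (1 - cos z) by exact: is_derive_eq.
have ch : continuous h.
  by move=> z; apply: differentiable_continuous; apply/derivable1_diffP; exact: ex_derive.
have : h 0 <= h y.
  apply: (@ger0_derive1_ndecry R h 0) => //.
  - move=> z _; rewrite derive1E (@derive_val _ _ _ _ _ _ _ (dh z)).
    by rewrite subr_ge0 cos_le1.
  - exact: continuous_subspaceT.
have -> : h 0 = 0 by change (0 - sin 0 = 0 :> R); rewrite sin0 subr0.
by change (0 <= y - sin y -> sin y <= y); rewrite subr_ge0.
Qed.

(** The chord of the sine over [0, pi / 2] has slope 2 / pi, which is at least 1 / 2 by [pi_le4]. *)
Lemma sin_ge_half y : 0 <= y <= 1 -> y / 2 <= sin y.
Proof.
move=> /andP[y0 y1]; have p2 : 0 < pi / 2 :> R by rewrite divr_gt0// pi_gt0.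
have yp : y / (pi / 2) <= 1.
  by rewrite ler_pdivrMr// mul1r (le_trans y1)// ler_pdivlMr// mul1r pi_ge2.
have := @sin_scale_ge (y / (pi / 2)) (pi / 2).
rewrite divr_ge0 ?(ltW p2)//= yp divfK ?gt_eqF// sin_pihalf mulr1 => H.
apply: le_trans (H isT _); last by have := pi_gt0 R; lra.
rewrite ler_wpM2l// lef_pV2 ?posrE//.
by rewrite ler_pdivrMr// -natrM pi_le4.
Qed.

Lemma cos_ge_quadratic y : 0 <= y -> 1 - y ^+ 2 / 2 <= cos y.
Proof.
move=> y0; have y2 : 0 <= y / 2 by rewrite divr_ge0.
rewrite [in leRHS](splitr y) cosD -!expr2 cos2sin2.
have : sin (y / 2) ^+ 2 <= (y / 2) ^+ 2.
  rewrite -ler_sqrt ?sqr_ge0// !sqrtr_sqr [leRHS]ger0_norm//.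
  rewrite ler_norml sin_le// andbT.
  have [y1|y1] := leP (y / 2) 1.
    have := @sin_ge_half (y / 2); rewrite y2 y1 => /(_ isT); lra.
  by rewrite (le_trans _ (sin_geN1 _))// lerN2 ltW.
rewrite exprMn exprVn; lra.
Qed.

Lemma ler_sin_01 y z : 0 <= y -> y <= z -> z <= 1 -> sin y <= sin z.
Proof.
move=> y0 yz z1; have p2 : 1 <= pi / 2 :> R by rewrite ler_pdivlMr// mul1r pi_ge2.
have m1 : y \in `[- (pi / 2), pi / 2] by rewrite in_itv/=; apply/andP; lra.
have m2 : z \in `[- (pi / 2), pi / 2] by rewrite in_itv/=; apply/andP; lra.
by rewrite leNgt ltr_sin// -leNgt.
Qed.

End trigonometric_bounds.

(** * Resonant tilts and their infimum *)

Section optimal_tilt.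
Context (R : realType) (nu : probability R R) (lambda : R).
Hypothesis lambda_gt0 : 0 < lambda.
Hypothesis nu_gt0 : (0 < nu `]0%R, +oo[%classic)%E.
Hypothesis stable : (lambda%:E * \int[nu]_x (Num.max 0 x)%:E < 1)%E.
Local Notation S theta omega b := (sin_mgf nu theta omega b).

Let admissible (b omega : R) :=
  [/\ 0 < b, 0 < omega, omega * b <= 1 & (0 < nu `[b, +oo[%classic)%E].

Let le_Rint (f g : R -> R) : nu.-integrable setT (EFin \o f) ->
  nu.-integrable setT (EFin \o g) -> (forall x, f x <= g x) ->
  \int[nu]_x f x <= \int[nu]_x g x.
Proof. by move=> fi gi fg; apply: le_Rintegral. Qed.

Let iS theta omega b : 0 <= theta -> 0 <= b -> nu.-integrable setT
  (EFin \o (fun x => expR (theta * clip b x) * sin (omega * clip b x))).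
Proof. by move=> t0 b0; exact: integrable_sin_mgf. Qed.

Let iC theta omega b : 0 <= theta -> 0 <= b -> nu.-integrable setT
  (EFin \o (fun x => expR (theta * clip b x) * cos (omega * clip b x))).
Proof. by move=> t0 b0; exact: integrable_cos_mgf. Qed.

Let iZ (k : R) g : nu.-integrable setT (EFin \o g) ->
  nu.-integrable setT (EFin \o (fun x => k * g x)).
Proof. by move=> ig; have := integrableZl measurableT k ig. Qed.

Let iE theta b : 0 <= theta -> 0 <= b ->
  nu.-integrable setT (EFin \o (fun x => expR (theta * clip b x))).
Proof.
move=> t0 b0; have := @iC theta 0 b t0 b0; congr integrable; apply/funext => x.
by rewrite /= mul0r cos0 mulr1.
Qed.

Let le_clip (b b' x : R) : b <= b' -> clip b x <= clip b' x.
Proof.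
move=> bb; rewrite /clip ge_max le_max lexx/= le_max; apply/orP; right.
by rewrite le_min !ge_min lexx bb orbT.
Qed.

Let clip01 (omega b x : R) : 0 < omega -> 0 < b -> omega * b <= 1 ->
  0 <= omega * clip b x <= 1.
Proof.
move=> o0 b0 ob; rewrite mulr_ge0 ?clip_ge0 ?(ltW o0)//=.
by rewrite (le_trans _ ob)// ler_wpM2l ?clip_le ?(ltW o0) ?(ltW b0).
Qed.

(* sin (omega c) / omega decreases in omega for omega c <= pi. *)
Let sin_mgf_mono theta theta' omega omega' b b' :
  0 <= theta <= theta' -> 0 < omega' <= omega -> 0 < b <= b' ->
  omega * b <= 1 -> omega' * b' <= 1 ->
  omega' * S theta omega b <= omega * S theta' omega' b'.
Proof.
move=> /andP[t0 tt] /andP[ o0 oleo] /andP[b0 bb] ob ob1.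
have og0 : 0 < omega by exact: lt_le_trans oleo.
have b0' : 0 < b' by exact: lt_le_trans bb.
have t0' : 0 <= theta' by exact: le_trans tt.
have i1 := @iS theta omega b t0 (ltW b0); have i2 := @iS theta' omega' b' t0' (ltW b0').
rewrite /sin_mgf -!RintegralZl//.
apply: le_Rint; [exact: iZ|exact: iZ|move=> x].
set c := clip b x.
set c' := clip b' x.
have cc : c <= c' by exact: le_clip.
have c0 : 0 <= c by exact: clip_ge0.
have /andP [ oc0 oc1] := clip01 x og0 b0 ob; have /andP [ oc0' oc1'] := clip01 x o0 b0' ob1.
have s1 : omega' * sin (omega * c) <= omega * sin (omega' * c).
  have := @sin_scale_ge R (omega' / omega) (omega * c).
  rewrite divr_ge0 ?(ltW o0) ?(ltW og0)//= ler_pdivrMr// mul1r oleo oc0 /=.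
  rewrite (le_trans oc1 (le_trans _ (pi_ge2 R))) ?ler1n// => /(_ isT isT).
  rewrite [omega' / omega * (omega * c)]mulrA divfK ?gt_eqF// => H.
  by rewrite -ler_pdivrMl// mulrA [_^-1 * _]mulrC.
have s2 : sin (omega' * c) <= sin (omega' * c').
  apply: ler_sin_01 => //; first by rewrite mulr_ge0 ?(ltW o0).
  by rewrite ler_wpM2l ?(ltW o0).
have s0 : 0 <= sin (omega * c).
  by apply: le_trans (sin_ge_half _); rewrite ?divr_ge0 ?oc0.
rewrite mulrCA [leRHS]mulrCA; apply: ler_pM.
- exact: expR_ge0.
- by rewrite mulr_ge0// ltW.
- by rewrite ler_expR ler_pM ?clip_ge0.
- by rewrite (le_trans s1)// ler_wpM2l ?(ltW og0).
Qed.

(** Stability enters here: as sin y <= y, the left-hand side is at most omega times lambda E B. So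
    tilt 0 lies strictly below resonance, which starts the intermediate value argument. *)
Let sin_mgf0 omega b : 0 < b -> 0 < omega -> lambda * S 0 omega b < omega.
Proof.
move=> b0 o0.
have ic : nu.-integrable setT (EFin \o clip b).
  apply: (@le_cst_integrable _ _ _ _ _ b); first exact: measurable_clip.
  by move=> x; rewrite ger0_norm ?clip_ge0// clip_le ?(ltW b0).
apply: (@le_lt_trans _ _ (lambda * (omega * \int[nu]_x clip b x))).
  rewrite ler_pM2l// /sin_mgf -RintegralZl//; apply: le_Rint.
  - exact: (@iS 0 omega b (lexx _) (ltW b0)).
  - exact: iZ.
  - by move=> x; rewrite mul0r expR0 mul1r sin_le// mulr_ge0 ?clip_ge0// ltW.
rewrite mulrCA -[ltRHS]mulr1 ltr_pM2l// -lte_fin.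
apply: le_lt_trans stable; rewrite EFinM lee_wpmul2l ?lee_fin ?(ltW lambda_gt0)//.
rewrite /Rintegral fineK; last exact: integrable_fin_num ic.
apply: ge0_le_integral => //.
- by move=> x _; rewrite lee_fin clip_ge0.
- by apply/measurable_EFinP; exact: measurable_clip.
- by apply/measurable_EFinP; apply: measurable_maxr.
- move=> x _; rewrite lee_fin /clip ge_max; apply/andP.
  by split; rewrite le_max ?ge_min lexx ?orbT.
Qed.

Let sin_mgf_continuous omega b theta1 : 0 <= theta1 -> 0 < b ->
  {within `[0, theta1], continuous (fun theta => S theta omega b)}.
Proof.
move=> t1 b0; apply: continuous_in_subspaceT => theta /set_mem /=.
rewrite in_itv/= => /andP[tt0 tt1].
pose f (theta x : R) := expR (theta * clip b x) * sin (omega * clip b x).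
have mf th : measurable_fun setT (f th).
  apply: measurable_funM.
    apply: measurableT_comp => //; apply: measurable_funM => //.
    exact: measurable_clip.
  apply: (measurableT_comp (f := @sin R)).
    by apply: continuous_measurable_fun; exact: continuous_sin.
  by apply: measurable_funM => //; exact: measurable_clip.
have fM th x : th < theta1 + 1 -> `|f th x| <= expR ((theta1 + 1) * b).
  move=> th1; rewrite normrM -[leRHS]mulr1 ler_pM ?sin_max//.
  rewrite ger0_norm ?expR_ge0// ler_expR.
  apply: (@le_trans _ _ ((theta1 + 1) * clip b x)).
    by rewrite ler_wpM2r ?clip_ge0// ltW.
  by rewrite ler_wpM2l ?clip_le ?addr_ge0// ltW.
apply: (@continuity_under_integral R _ _ nu f setT measurableT (-1) (theta1 + 1)
  _ _ (fun=> expR ((theta1 + 1) * b))).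
- move=> th; rewrite /= in_itv/= => /andP[_ th1].
  exact: (@le_cst_integrable _ _ _ nu (f th) _ (mf th) (fun x => fM th x th1)).
- apply: aeW => x _ th _; apply: cvgM; last exact: cvg_cst.
  have cl : {for th, continuous (fun t : R => t * clip b x)}.
    by apply: cvgM; [exact: cvg_id|exact: cvg_cst].
  exact: (continuous_comp cl (@continuous_expR R _)).
- exact: finite_measure_integrable_cst.
- by move=> th; rewrite /= in_itv/= => /andP[_ th1]; apply: aeW => x _; exact: fM.
- by rewrite inE/= in_itv/=; apply/andP; lra.
Qed.

(** An inequality instead of resonance, because it persists when b grows and omega shrinks
    ([tilt_refine]); [resonance_exists] then recovers equality at a tilt no larger than the given
    one. *)
Let tilts := [set theta | 0 <= theta /\
  exists b omega, admissible b omega /\ omega <= lambda * S theta omega b].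

Let resonance_exists b omega theta1 : 0 <= theta1 -> admissible b omega ->
  omega <= lambda * S theta1 omega b ->
  exists2 theta, 0 <= theta <= theta1 & lambda * S theta omega b = omega.
Proof.
move=> t1 [b0 o0 ob nb] H.
have := @IVT R (fun theta => S theta omega b) 0 theta1 (omega / lambda) t1
  (@sin_mgf_continuous omega b theta1 t1 b0).
have H0 := sin_mgf0 b0 o0.
have a1 : S 0 omega b <= omega / lambda by rewrite ler_pdivlMr// mulrC ltW.
have a2 : omega / lambda <= S theta1 omega b by rewrite ler_pdivrMr// mulrC.
case; first by rewrite ge_min a1 le_max a2 orbT.
move=> theta; rewrite in_itv/= => t01 E; exists theta => //.
by rewrite E mulrC divfK ?gt_eqF.
Qed.

Let support := [set b : R | 0 < b /\ (0 < nu `[b, +oo[%classic)%E].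

Let null_ray (a : R) :
  (forall n : nat, ~ (0 < nu `[(a + n.+1%:R^-1 : R)%R, +oo[%classic)%E) ->
  (nu `]a, +oo[%classic = 0)%E.
Proof.
move=> nu0; apply/eqP; rewrite -measure_le0.
have -> : `]a, +oo[%classic = \bigcup_n `[(a + n.+1%:R^-1 : R), +oo[%classic :> set R.
  apply/seteqP; split => [x /=|x [n _]/=]; rewrite !in_itv/= !andbT.
    move=> ax; have [n xn] := ltr_add_invr ax.
    by exists n => //=; rewrite in_itv/= andbT ltW.
  by apply: lt_le_trans; rewrite ltrDl invr_gt0.
apply: (le_trans (@generalized_Boole_inequality _ _ _ nu _ _ _)) => //.
  exact: bigcupT_measurable.
rewrite eseries0// => n _ _; apply/eqP; rewrite -measure_le0 leNgt.
by apply/negP; exact: nu0.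
Qed.

Let support_nonempty : support !=set0.
Proof.
have [n bn] : exists n : nat, (0 < nu `[(0 + n.+1%:R^-1 : R)%R, +oo[%classic)%E.
  apply: contrapT => /forallNP /null_ray nu0; move: nu_gt0.
  by rewrite nu0 ltxx.
by exists (0 + n.+1%:R^-1); split => //; rewrite add0r invr_gt0.
Qed.

Let support_down b b' : support b -> 0 < b' -> b' <= b -> support b'.
Proof.
move=> [b0 bn] b0' bb; split => //; apply: (lt_le_trans bn).
apply: le_measure; rewrite ?inE//.
by move=> x /=; rewrite !in_itv/= !andbT; exact: le_trans.
Qed.

Let tilts_nonempty : tilts !=set0.
Proof.
have [b [b0 bn]] := support_nonempty.
have nfin : nu `[b, +oo[%classic \is a fin_num by exact: fin_num_measure.
pose p := fine (nu `[b, +oo[%classic).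
have p0 : 0 < p by rewrite fine_gt0// bn ltey_eq nfin.
pose omega := b^-1; have o0 : 0 < omega by rewrite invr_gt0.
have ob : omega * b = 1 by rewrite mulVf// gt_eqF.
(* This theta solves theta b p / 2 = omega / lambda. Only services of at least b are counted, with
   sin 1 >= 1 / 2 and exp y >= y. *)
pose theta := 2 * omega / (lambda * p) / b.
have t0 : 0 <= theta by rewrite !divr_ge0 ?mulr_ge0// ltW.
exists theta; split => //; exists b, omega; split; first by split => //; rewrite ob.
rewrite -ler_pdivrMl// mulrC.
have iI : nu.-integrable setT (EFin \o (fun x => (expR (theta * b) / 2) * \1_(`[b, +oo[%classic) x)).
  apply: iZ; apply: (@le_cst_integrable _ _ _ _ _ 1) => // x.
  by rewrite indicE; case: (_ \in _); rewrite ?normr1 ?normr0.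
apply: (@le_trans _ _ (\int[nu]_x ((expR (theta * b) / 2) * \1_(`[b, +oo[%classic) x))).
  rewrite RintegralZl//; last first.
    apply: (@le_cst_integrable _ _ _ _ _ 1) => // x.
    by rewrite indicE; case: (_ \in _); rewrite ?normr1 ?normr0.
  rewrite /Rintegral integral_indic// setIT -/p.
  apply: (@le_trans _ _ ((theta * b) / 2 * p)).
    rewrite /theta divfK ?gt_eqF//; rewrite le_eqVlt; apply/orP; left; apply/eqP.
    by field; rewrite !gt_eqF.
  rewrite ler_wpM2r ?(ltW p0)// ler_wpM2r//.
  by apply: le_trans (expR_ge1Dx _); rewrite lerDr.
apply: le_Rint => //; first exact: (@iS theta omega b t0 (ltW b0)).
move=> x; rewrite indicE; case: (boolP (x \in _)) => [|_].
  rewrite inE/= in_itv/= andbT => bx; rewrite mulr1.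
  have -> : clip b x = b.
    by rewrite /clip (min_idPr bx) (max_idPr _)// ltW.
  by rewrite ler_wpM2l ?expR_ge0// ob (le_trans _ (@sin_ge_half R 1 _)) ?div1r ?ler01 ?lexx.
rewrite mulr0 mulr_ge0 ?expR_ge0//.
have := @clip01 omega b x o0 b0; rewrite ob => /(_ (lexx _)) c01.
apply: le_trans (sin_ge_half c01); rewrite divr_ge0//.
by case/andP: c01.
Qed.

(* The levels must charge [b, +oo[, so that a service time reaches them with
   positive probability, and yet exhaust the support of nu. *)
Let cofinal_support : exists u : nat -> R,
  [/\ forall k, support (u k), forall j k, (j <= k)%N -> u j <= u k &
      {ae nu, forall x, exists k, x <= u k}].
Proof.
(* Three cases: unbounded levels, a largest level, and a finite supremum that is not itself a
   level. *)
have [ub|nub] := pselect (has_ubound support); last first.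
  exists (fun k => k.+1%:R); split.
  - move=> k; have [b sb kb] : exists2 b, support b & k.+1%:R <= b.
      apply: contrapT => H; apply: nub; exists k.+1%:R => b sb.
      by rewrite leNgt; apply/negP => /ltW kb; apply: H; exists b.
    exact: (support_down sb).
  - by move=> j k jk; rewrite ler_nat.
  - apply: aeW => x; exists (Num.truncn x); exact/ltW/truncnS_gt.
pose beta := sup support.
have hs : has_sup support by split.
have beta_ub b : support b -> b <= beta by move=> sb; exact: ub_le_sup.
have beta0 : 0 < beta.
  by have [b sb] := support_nonempty; apply: lt_le_trans (beta_ub _ sb); case: sb.
have [sbeta|nsbeta] := pselect (support beta).
  exists (fun=> beta); split => //.
  exists `]beta, +oo[%classic; split => //.
    apply: null_ray => n nb.
    have : support (beta + n.+1%:R^-1) by split => //; rewrite addr_gt0// invr_gt0.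
    by move/beta_ub; rewrite leNgt ltrDl invr_gt0 ltr0Sn.
  move=> x /= /forallNP /(_ 0%N) /negP; rewrite -ltNge.
  by rewrite in_itv/= andbT.
(* The levels increase to beta from below; k + 2 in place of k + 1 keeps the first of them
   positive. *)
exists (fun k => beta - beta * k.+2%:R^-1); split.
- move=> k; have [b sb kb] : exists2 b, support b & beta - beta * k.+2%:R^-1 < b.
    by apply: sup_adherent => //; rewrite mulr_gt0// invr_gt0.
  apply: (support_down sb _ (ltW kb)).
  by rewrite subr_gt0 -[ltRHS]mulr1 ltr_pM2l// invf_lt1// ltr1n.
- move=> j k jk; rewrite lerD2l lerN2 ler_pM2l// lef_pV2 ?posrE//.
  by rewrite ler_nat.
- exists `[beta, +oo[%classic; split => //.
    apply/eqP; rewrite -measure_le0 leNgt; apply/negP => nb.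
    by apply: nsbeta; split.
  move=> x /= /forallNP H; rewrite in_itv/= andbT leNgt; apply/negP => xb.
  have d0 : 0 < (beta - x) / beta by rewrite divr_gt0// subr_gt0.
  have [n nd] := ltr_add_invr d0; apply: (H n).
  rewrite lerBrDr -lerBrDl mulrC -ler_pdivlMr//.
  rewrite add0r in nd; apply: (le_trans _ (ltW nd)).
  by rewrite lef_pV2 ?posrE// ler_nat.
Qed.

Hypothesis nu_ge0 : {ae nu, forall x, 0 <= x}.

(** For almost every x the clipped value equals x from some k on, and monotone convergence passes
    the uniform bound to the limit. It serves both to show the transform finite and to approximate
    it by clipped ones. *)
Let mgf_fatou (u : nat -> R) theta L : 0 <= theta -> (forall k, 0 < u k) ->
  (forall j k, (j <= k)%N -> u j <= u k) -> {ae nu, forall x, exists k, x <= u k} ->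
  (forall k, \int[nu]_x expR (theta * clip (u k) x) <= L) ->
  (\int[nu]_x (expR (theta * x))%:E <= L%:E)%E.
Proof.
move=> t0 u0 nd cof uL.
have mE b : measurable_fun setT (fun x => (expR (theta * clip b x))%:E).
  apply/measurable_EFinP; apply: measurableT_comp => //.
  by apply: measurable_funM => //; exact: measurable_clip.
pose f k x := (expR (theta * clip (u k) x))%:E.
have f0 k x : (0 <= f k x)%E by rewrite lee_fin expR_ge0.
have ndf x : nondecreasing_seq (f^~ x).
  move=> j k jk; rewrite lee_fin ler_expR ler_wpM2l//.
  by apply: le_clip; exact: nd.
have cf x : cvgn (f^~ x) by exact: ereal_nondecreasing_is_cvgn.
have mlim : measurable_fun setT (fun x => limn (f^~ x)).
  by apply: (emeasurable_fun_cvg f) => [k|x _]; [exact: mE|exact: cf].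
apply: (@le_trans _ _ (\int[nu]_x limn (f^~ x))%E).
  apply: ae_ge0_le_integral => //.
  - by apply/measurable_EFinP; apply: measurableT_comp.
  - by move=> x _; apply: lime_ge => //; apply: nearW => k.
  move: cof nu_ge0; apply: filterS2 => x [k xk] x0 _.
  apply: lime_ge => //; exists k => // n /= kn.
  by rewrite /f /clip (min_idPl _) ?(max_idPr x0)// (le_trans xk)// nd.
rewrite monotone_convergence//; last by move=> n; exact: mE.
apply: lime_le.
  apply: ereal_nondecreasing_is_cvgn => j k jk.
  apply: ge0_le_integral => //; [exact: mE|exact: mE|].
  by move=> x _; exact: ndf.
apply: nearW => n; rewrite -[leLHS]fineK ?lee_fin; first exact: uL.
exact: (integrable_fin_num measurableT (@iE theta (u n) t0 (ltW (u0 n)))).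
Qed.

(** By [sin_mgf_mono] the ratio S / omega can only grow under such a change. *)
Let tilt_refine theta b omega b' omega' : 0 <= theta -> admissible b omega ->
  omega <= lambda * S theta omega b -> admissible b' omega' ->
  b <= b' -> omega' <= omega -> omega' <= lambda * S theta omega' b'.
Proof.
move=> t0 [b0 o0 ob _] H [b0' o0' ob' _] bb oleo.
have : omega' * S theta omega b <= omega * S theta omega' b'.
  by apply: sin_mgf_mono => //; rewrite ?t0 ?lexx ?o0' ?oleo ?b0 ?bb.
rewrite -(ler_pM2l lambda_gt0) mulrCA [leRHS]mulrCA => H2.
rewrite -(ler_pM2l o0); apply: le_trans H2.
by rewrite mulrC ler_pM2l.
Qed.

Let tilts_inf_ge0 : 0 <= inf tilts.
Proof. by apply: lb_le_inf => // theta []. Qed.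

Let tilts_lb theta : tilts theta -> inf tilts <= theta.
Proof. by move=> tt; apply: ge_inf => //; exists 0 => t []. Qed.

(** Here theta is the infimum of [tilts] and m its transform. A resonant tilt is never below theta,
    so its exponential weight dominates that of theta, and for small omega the cosine costs little:
    [cos_mgf] is then almost at least m, while the tilt is almost theta. *)
Lemma exists_optimal_tilt : exists theta m : R,
  [/\ 0 <= theta, (\int[nu]_x (expR (theta * x))%:E <= m%:E)%E &
   forall e, 0 < e -> exists b omega theta',
     [/\ 0 < b, 0 < omega, omega * b <= 1, (0 < nu `[b, +oo[%classic)%E &
      [/\ 0 <= theta', lambda * S theta' omega b = omega &
          bump_rate nu lambda theta' omega b <= theta - lambda * (m - 1) + e]]].
Proof.
have [u [su ndu cofu]] := cofinal_support.
have i0 := tilts_inf_ge0; set ts := inf tilts in i0 *.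
pose M b := \int[nu]_x expR (ts * clip b x).
have [theta1 [t10 [b1 [omega1 [[b10 o10 ob1 nb1] H1]]]]] := tilts_nonempty.
have sb1 : support b1 by [].
have adm1 : admissible b1 omega1 by [].
(* With all levels at least b1, [tilt_refine] carries the inequality from b1 and omega1 to every v
   k. *)
pose v k := Num.max (u k) b1.
have sv k : support (v k) by rewrite /v maxEle; case: ifP.
have v0 k : 0 < v k by case: (sv k).
have vb k : b1 <= v k by rewrite le_max lexx orbT.
have ndv j k : (j <= k)%N -> v j <= v k.
  move=> jk; rewrite /v ge_max vb andbT.
  by rewrite le_max ndu.
have cofv : {ae nu, forall x, exists k, x <= v k}.
  move: cofu; apply: filterS => x [k xk]; exists k.
  by rewrite le_max xk.
have refine b omega theta : 0 <= theta -> admissible b omega ->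
    omega <= lambda * S theta omega b ->
    exists theta', [/\ ts <= theta', theta' <= theta & lambda * S theta' omega b = omega].
  move=> th0 adm H; have [theta' /andP[t0 tt] E] := resonance_exists th0 adm H.
  exists theta'; split => //; apply: tilts_lb; split => //.
  by exists b, omega; split => //; rewrite E.
(* With omega <= 1 / v k and lambda S = omega, the mass of the mgf beyond 1 is at
   most 2 / omega times S, because sin y >= y / 2 on [0, 1]. *)
have ML k : M (v k) <= expR theta1 + 2 / lambda.
  pose omega := Num.min omega1 (v k)^-1.
  have o0 : 0 < omega by rewrite lt_min o10 invr_gt0 v0.
  have ob : omega * v k <= 1.
    by rewrite -ler_pdivlMr// mul1r ge_min lexx orbT.
  have adm : admissible (v k) omega by split => //; case: (sv k).
  have oo1 : omega <= omega1 by rewrite ge_min lexx.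
  have [theta' [t' tt' E]] := refine _ _ _ t10 adm (tilt_refine t10 adm1 H1 adm (vb k) oo1).
  have t0' : 0 <= theta' by exact: le_trans t'.
  have -> : 2 / lambda = 2 / omega * S theta' omega (v k).
    have -> : S theta' omega (v k) = omega / lambda.
      by rewrite -[in RHS]E mulrC mulKf ?gt_eqF.
    by rewrite mulrA divfK// gt_eqF.
  have i1 := @iS theta' omega (v k) t0' (ltW (v0 k)).
  have i2 : nu.-integrable setT (EFin \o cst (expR theta1)).
    exact: finite_measure_integrable_cst.
  have <- : \int[nu]_x expR theta1 = expR theta1.
    rewrite Rintegral_cst// [X in _ * fine X](_ : _ = 1%E) ?mulr1//.
    exact: probability_setT.
  rewrite /sin_mgf -RintegralZl// -RintegralD//; last exact: iZ.
  apply: le_Rint => [||x].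
  - exact: (@iE ts (v k) i0 (ltW (v0 k))).
  - exact: (integrableD measurableT i2 (iZ _ i1)).
  set c := clip (v k) x; have c0 : 0 <= c by exact: clip_ge0.
  have oc01 := clip01 x o0 (v0 k) ob; have so := sin_ge_half oc01.
  have /andP[oc0 _] := oc01.
  have tc : expR (ts * c) <= expR (theta' * c) by rewrite ler_expR ler_wpM2r.
  have [c1|c1] := leP c 1.
    apply: ler_wpDr.
      rewrite mulr_ge0 ?divr_ge0 ?(ltW o0)// mulr_ge0 ?expR_ge0//.
      by apply: le_trans so; rewrite divr_ge0.
    rewrite ler_expR (le_trans (ler_wpM2r c0 (le_trans t' tt')))//.
    by rewrite ler_piMr.
  apply: ler_wpDl; first exact: expR_ge0.
  apply: (le_trans tc); rewrite mulrCA -[leLHS]mulr1 ler_wpM2l ?expR_ge0//.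
  rewrite -ler_pdivrMl ?divr_gt0// mulr1 invf_div.
  apply: le_trans so; rewrite ler_wpM2r// -[leLHS]mulr1 ler_wpM2l ?(ltW o0)//.
  exact: ltW.
have Mfin := mgf_fatou i0 v0 ndv cofv ML.
have Mge0 : (0 <= \int[nu]_x (expR (ts * x))%:E)%E.
  by apply: integral_ge0 => x _; rewrite lee_fin expR_ge0.
have fM : (\int[nu]_x (expR (ts * x))%:E)%E \is a fin_num.
  by rewrite ge0_fin_numE// (le_lt_trans Mfin)// ltry.
pose m := fine (\int[nu]_x (expR (ts * x))%:E)%E.
exists ts, m; split => //; first by rewrite /m fineK.
(* The tilt will exceed theta by less than eta, and [cos_mgf] will be at least m - 2 eta, once for
   truncation and once for the cosine: together eta + 2 lambda eta = e. *)
move=> e e0; pose eta := e / (1 + 2 * lambda).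
have l2 : 0 < 1 + 2 * lambda by rewrite addr_gt0// mulr_gt0.
have eta0 : 0 < eta by rewrite divr_gt0.
have [k Mk] : exists k, m - eta < M (v k).
  apply: contrapT => /forallNP H.
  have : (m%:E <= (m - eta)%:E)%E.
    rewrite {1}/m fineK//; apply: (mgf_fatou i0 v0 ndv cofv) => k.
    by rewrite leNgt; apply/negP; exact: H.
  by rewrite lee_fin leNgt ltrBlDr ltrDl eta0.
have [theta2 [t20 [b2 [omega2 [adm2 H2]]]] t2e] :
    exists2 theta2, tilts theta2 & theta2 < ts + eta.
  by apply: inf_adherent => //; split => //; exists 0 => t [].
have [b20 o20 ob2 nb2] := adm2.
pose b := Num.max (v k) b2.
have sb : support b by rewrite /b maxEle; case: ifP => _ //; split.
have [b0 nb] := sb.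
(* Here [kappa] bounds the phase omega b and is not the Laplace exponent. Then the cosine is at
   least 1 - kappa, and the loss exp (ts c) kappa is at most eta for all c <= b. *)
pose kappa := Num.min 1 (eta / expR (ts * b)).
have kappa0 : 0 < kappa by rewrite lt_min ltr01 divr_gt0 ?expR_gt0.
pose omega := Num.min omega2 (kappa / b).
have o0 : 0 < omega by rewrite lt_min o20 divr_gt0.
have obk : omega * b <= kappa by rewrite -ler_pdivlMr// ge_min lexx orbT.
have k1 : kappa <= 1 by rewrite ge_min lexx.
have ob : omega * b <= 1 by exact: le_trans k1.
have adm : admissible b omega by split.
have bb2 : b2 <= b by rewrite le_max lexx orbT.
have oo2 : omega <= omega2 by rewrite ge_min lexx.
have [theta' [t' tt' E]] := refine _ _ _ t20 adm (tilt_refine t20 adm2 H2 adm bb2 oo2).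
have t0' : 0 <= theta' by exact: le_trans t'.
exists b, omega, theta'; do 2 (split => //).
have i1 := @iE ts b i0 (ltW b0).
have icst : nu.-integrable setT (EFin \o cst eta).
  exact: finite_measure_integrable_cst.
have C_ge : M b - eta <= cos_mgf nu theta' omega b.
  have -> : M b - eta = \int[nu]_x (expR (ts * clip b x) - eta).
    rewrite RintegralB// Rintegral_cst// [X in _ * fine X](_ : _ = 1%E) ?mulr1//.
    exact: probability_setT.
  apply: le_Rint => [||x].
  - exact: (integrableB measurableT i1 icst).
  - exact: (@iC theta' omega b t0' (ltW b0)).
  have /andP[oc0 oc1] := clip01 x o0 b0 ob.
  set c := clip b x in oc0 oc1 *; have c0 : 0 <= c by exact: clip_ge0.
  have cb : c <= b by rewrite clip_le// ltW.
  have ock : omega * c <= kappa by rewrite (le_trans _ obk)// ler_wpM2l// ltW.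
  have cosq := cos_ge_quadratic oc0.
  have sq : (omega * c) ^+ 2 <= kappa.
    rewrite expr2 (le_trans (ler_wpM2r oc0 ock))// -[leRHS]mulr1.
    by rewrite ler_wpM2l// ltW.
  have cos0 : 0 <= cos (omega * c) by apply: le_trans cosq; lra.
  apply: (@le_trans _ _ (expR (ts * c) * cos (omega * c))); last first.
    by rewrite ler_wpM2r// ler_expR ler_wpM2r.
  apply: (@le_trans _ _ (expR (ts * c) * (1 - kappa))); last first.
    by rewrite ler_wpM2l ?expR_ge0//; lra.
  rewrite mulrBr mulr1 lerD2l lerN2.
  apply: (@le_trans _ _ (expR (ts * b) * (eta / expR (ts * b)))).
    apply: ler_pM; rewrite ?expR_ge0 ?(ltW kappa0)//.
      by rewrite ler_expR ler_wpM2l.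
    by rewrite /kappa ge_min lexx orbT.
  by rewrite mulrC divfK ?gt_eqF ?expR_gt0.
have Mb : m - eta <= M b.
  apply: (le_trans (ltW Mk)); apply: le_Rint => [||x].
  - exact: (@iE ts (v k) i0 (ltW (v0 k))).
  - exact: i1.
  by rewrite ler_expR ler_wpM2l// le_clip// le_max lexx.
have eE : e = eta + 2 * lambda * eta.
  by rewrite /eta; field; rewrite gt_eqF.
rewrite /bump_rate eE.
have H3 : lambda * (m - eta - eta) <= lambda * cos_mgf nu theta' omega b.
  by rewrite ler_wpM2l ?(ltW lambda_gt0)//; lra.
lra.
Qed.

End optimal_tilt.

(** * Decay rates *)

Section log_tail_bounds.
Context d (Om : measurableType d) (R : realType) (P : probability Om R).
Variable X : {RV P >-> R}.
Local Open Scope ereal_scope.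

Lemma ccdfE (x : R) : ccdf X x = P [set w | (x < X w)%R].
Proof.
by congr (P _); apply/seteqP; split => w /=; rewrite in_itv/= andbT.
Qed.

Lemma lne_expR_prod (C a x : R) : (0 < C)%R ->
  lne (C * expR (- (a * x)))%:E = (ln C - a * x)%:E.
Proof.
move=> C0; rewrite lne_EFin ?mulr_gt0 ?expR_gt0//.
by rewrite lnM ?posrE ?expR_gt0// expRK.
Qed.

Lemma log_tail_le (C a e : R) : (0 < e)%R ->
  (forall x, (0 <= x)%R -> P [set w | (x < X w)%R] <= (C * expR (- (a * x)))%:E) ->
  \forall x \near +oo%R, log_tail X x <= (- a + e)%:E.
Proof.
(* A constant that is certainly positive has a logarithm, which is negligible against x. *)
move=> e0 H; pose C1 := Num.max 1%R C.
have C10 : (0 < C1)%R by rewrite lt_max ltr01.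
near=> x.
have x0 : (0 < x)%R by near: x; exact: nbhs_pinfty_gt.
have xC : (ln C1 / e <= x)%R by near: x; apply: nbhs_pinfty_ge; exact: num_real.
have le1 : lne (ccdf X x) <= (ln C1 - a * x)%:E.
  rewrite -lne_expR_prod// lee_lne ?ccdfE ?in_itv/= ?measure_ge0 ?leey//.
  - apply: (le_trans (H x (ltW x0))); rewrite lee_fin ler_wpM2r ?expR_ge0//.
    by rewrite le_max lexx orbT.
  - by rewrite lee_fin mulr_ge0 ?expR_ge0// ltW.
have ix0 : (0 <= x^-1)%R by rewrite invr_ge0 ltW.
apply: (le_trans (lee_wpmul2l _ le1)); rewrite ?lee_fin//.
rewrite mulrBr mulrCA mulVf ?gt_eqF// mulr1 addrC lerD2l.
by rewrite mulrC ler_pdivrMr// mulrC -ler_pdivrMr.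
Unshelve. all: by end_near. Qed.

Lemma log_tail_ge (c a e : R) : (0 < e)%R -> (0 < c)%R ->
  (forall x, (0 < x)%R -> (c * expR (- (a * x)))%:E <= P [set w | (x < X w)%R]) ->
  \forall x \near +oo%R, (- a - e)%:E <= log_tail X x.
Proof.
move=> e0 c0 H; near=> x.
have x0 : (0 < x)%R by near: x; exact: nbhs_pinfty_gt.
have xC : (- ln c / e <= x)%R by near: x; apply: nbhs_pinfty_ge; exact: num_real.
have le1 : (ln c - a * x)%:E <= lne (ccdf X x).
  rewrite -lne_expR_prod// lee_lne ?ccdfE ?in_itv/= ?measure_ge0 ?leey//.
  - exact: H.
  - by rewrite lee_fin mulr_ge0 ?expR_ge0// ltW.
have ix0 : (0 <= x^-1)%R by rewrite invr_ge0 ltW.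
apply: le_trans (lee_wpmul2l _ le1); rewrite ?lee_fin//.
rewrite mulrBr mulrCA mulVf ?gt_eqF// mulr1 addrC lerD2r.
by rewrite lerNl mulrC -mulNr ler_pdivrMr// mulrC -ler_pdivrMr.
Unshelve. all: by end_near. Qed.

Lemma log_tail_le0 (x : R) : (0 < x)%R -> log_tail X x <= 0.
Proof.
move=> x0; apply: mule_ge0_le0; first by rewrite lee_fin invr_ge0 ltW.
by rewrite lne_le0 ccdfE probability_le1//; exact: measurable_lt_set.
Qed.

Lemma log_tail_cvg (a : R) :
  (forall e, (0 < e)%R -> \forall x \near +oo%R, log_tail X x <= (- a + e)%:E) ->
  (forall e, (0 < e)%R -> \forall x \near +oo%R, (- a - e)%:E <= log_tail X x) ->
  log_tail X x @[x --> +oo%R] --> (- a)%:E.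
Proof.
move=> Hle Hge.
(* The lower bound excludes -oo and a probability being at most 1 excludes +oo, so convergence can
   be proved among the reals. *)
have fin : \forall x \near +oo%R, log_tail X x \is a fin_num.
  near=> x; have x0 : (0 < x)%R by near: x; exact: nbhs_pinfty_gt.
  rewrite fin_numElt; apply/andP; split.
  - by apply: (@lt_le_trans _ _ (- a - 1)%:E); [exact: ltNyr|near: x; exact: Hge].
  - exact: le_lt_trans (log_tail_le0 x0) _.
apply: cvg_EFin => //; apply/cvgrPdist_le => e e0; near=> x.
have fx : log_tail X x \is a fin_num by near: x.
rewrite ler_distlC -!lee_fin /= fineK//; apply/andP; split.
- by near: x; exact: Hge.
- by near: x; exact: Hle.
Unshelve. all: by end_near. Qed.

Lemma lim_log_tail_le (a : R) : has_decay_rate X ->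
  (forall e, (0 < e)%R -> \forall x \near +oo%R, log_tail X x <= (- a + e)%:E) ->
  lim (log_tail X x @[x --> +oo%R]) <= (- a)%:E.
Proof.
move=> cvgX H; apply/lee_addgt0Pr => e e0.
by apply: lime_le => //; exact: H.
Qed.

End log_tail_bounds.

Section service_law.
Context d (Om : measurableType d) (R : realType) (P : probability Om R).
Variable B : {RV P >-> R}.
Hypothesis B_ge0 : {ae P, forall w, 0 <= B w}.

Lemma distribution_ae_ge0 : {ae distribution P B, forall x, 0 <= x}.
Proof.
case: B_ge0 => N [mN PN sN]; exists `]-oo, 0[%classic; split => //.
- apply: (@subset_measure0 _ _ _ P (B @^-1` `]-oo, 0[%classic) N) => //.
    by rewrite -[X in measurable X]setTI; exact: measurable_funP.
  move=> w /=; rewrite in_itv/= => Bw; apply: sN => /=.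
  by rewrite leNgt Bw.
- by move=> x /= /negP; rewrite in_itv/= ltNge.
Qed.

Lemma distribution_gt0 : ~ {ae P, forall w, B w = 0} ->
  (0 < distribution P B `]0%R, +oo[%classic)%E.
Proof.
move=> B0; rewrite lt0e measure_ge0 andbT; apply/eqP => E; apply: B0.
have pos : {ae P, forall w, ~ (0 < B w)}.
  exists (B @^-1` `]0, +oo[%classic); split => //.
  - by rewrite -[X in measurable X]setTI; exact: measurable_funP.
  - by move=> w /= /contrapT; rewrite in_itv/= andbT.
move: pos B_ge0; apply: filterS2 => w /negP; rewrite -leNgt => B1 B2.
by apply/eqP; rewrite eq_le B1 B2.
Qed.

Lemma distribution_mean :
  (\int[distribution P B]_x (Num.max 0 x)%:E)%E = ('E_P[B])%E.
Proof.
have mmax : measurable_fun setT (fun x : R => (Num.max 0 x)%:E).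
  by apply/measurable_EFinP; exact: measurable_maxr.
rewrite ge0_integral_distribution//; last first.
  by move=> y; rewrite lee_fin le_max lexx.
rewrite expectation_def; apply: ae_eq_integral => //.
- exact: measurableT_comp.
- exact/measurable_EFinP.
move: B_ge0; apply: filterS => w Bw _ /=.
by rewrite max_r.
Qed.

End service_law.

(** * Logarithmic asymptotics of the two tails *)

Section mg1_tails.
Context d (Om : measurableType d) (R : realType) (P : probability Om R).
Context (Q : queue P) (nu : probability R R) (lambda theta m : R).
Hypotheses (lambda_gt0 : 0 < lambda) (mg1Q : stationary_mg1 Q lambda nu).
Local Notation delta := (theta - lambda * (m - 1)).

Lemma work_conserving_log_tail_le : 0 <= theta -> 1 <= m ->
  (\int[nu]_x (expR (theta * x))%:E <= m%:E)%E -> work_conserving Q ->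
  forall e, 0 < e ->
    \forall x \near +oo, (log_tail (sojourn Q 0) x <= (- delta + e)%:E)%E.
Proof.
move=> theta0 m1 mgf wcQ e e0; have [[indepQ expo servE] validQ statQ] := mg1Q.
(* Half of e lifts s above the threshold lambda (m - 1) of [sojourn_tail_le]; the other half absorbs
   the constant C. *)
pose s := lambda * (m - 1) + e / 2.
have s0 : 0 < s by rewrite ltr_wpDl ?divr_gt0// mulr_ge0 ?subr_ge0// ltW.
have -> : - delta + e = - (theta - s) + e / 2 by rewrite /s; lra.
suff [C HC] : exists C : R, forall x, 0 <= x ->
    (P [set w | (x < sojourn Q 0 w)%R] <= (C * expR (- ((theta - s) * x)))%:E)%E.
  by apply: log_tail_le HC; rewrite divr_gt0.
have [st|ts] := ltP s theta.
  apply: (@sojourn_tail_le _ _ _ _ _ lambda m) => //.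
  - move=> n; rewrite (_ : \int[_]_x _ = \int[nu]_x (expR (theta * x))%:E)%E//.
    by apply: eq_measure_integral => A mA _; exact: servE.
  - by rewrite /s; lra.
(* For s >= theta the exponential is at least 1 and bounds any probability. *)
exists 1 => x x0; rewrite mul1r.
apply: (@le_trans _ _ 1%E).
  by apply: probability_le1; exact: measurable_lt_set.
by rewrite lee_fin -[leLHS]expR0 ler_expR oppr_ge0 mulr_le0_ge0// subr_le0.
Qed.

Lemma fb_log_tail_ge :
  (forall e, 0 < e -> exists b omega theta',
    [/\ 0 < b, 0 < omega, omega * b <= 1, (0 < nu `[b, +oo[%classic)%E &
    [/\ 0 <= theta', lambda * sin_mgf nu theta' omega b = omega &
        bump_rate nu lambda theta' omega b <= delta + e]]) ->
  foreground_background Q ->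
  forall e, 0 < e ->
    \forall x \near +oo, ((- delta - e)%:E <= log_tail (sojourn Q 0) x)%E.
Proof.
move=> tilt fbQ e e0; have [[indepQ expo servE] validQ statQ] := mg1Q.
have e20 : 0 < e / 2 by rewrite divr_gt0.
have [b [omega [theta' [b0 o0 ob nb [t0 res rate]]]]] := tilt _ e20.
pose c := fine (nu `[b, +oo[%classic) * bump theta' omega b / bump_max theta' omega.
have c0 : 0 < c.
  rewrite /c divr_gt0 ?expR_gt0// mulr_gt0//.
    by rewrite fine_gt0// nb -ge0_fin_numE ?fin_num_measure.
  rewrite /bump b0 ltr_pdivlMr// mulrC.
  (* The initial workload b lies strictly inside the arch of the sine, so the constant c is
     positive. *)
  have obpi : omega * b < pi by rewrite (le_lt_trans ob)// (lt_le_trans _ (pi_ge2 R))// ltr1n.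
  by rewrite obpi mulr_gt0 ?expR_gt0// sin_gt0_pi// mulr_gt0.
have -> : - delta - e = - (delta + e / 2) - e / 2 by lra.
apply: (log_tail_ge e20 c0) => x x0.
apply: le_trans (fb_sojourn_tail_ge lambda_gt0 t0 o0 b0 ob res indepQ expo servE x0 validQ fbQ).
rewrite lee_fin -/c ler_wpM2l ?(ltW c0)// ler_expR lerN2.
by rewrite ler_wpM2r ?(ltW x0).
Qed.

Lemma foreground_background_work_conserving :
  foreground_background Q -> work_conserving Q.
Proof.
have [_ validQ _] := mg1Q.
by move: validQ; apply: filterS2 => w sp fb t; exact: (fb_work_conserving sp fb).
Qed.

End mg1_tails.

Theorem corollary7 (R : realType) (lambda : R)
  (d0 : measure_display) (T0 : measurableType d0) (P0 : probability T0 R)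
  (B : {RV P0 >-> R})
  (d1 : measure_display) (T1 : measurableType d1) (P1 : probability T1 R)
  (FB : queue P1)
  (d2 : measure_display) (T2 : measurableType d2) (P2 : probability T2 R)
  (Pi : queue P2) :
  0 < lambda ->
  {ae P0, forall w, 0 <= B w} ->
  ~ {ae P0, forall w, B w = 0} ->
  (lambda%:E * 'E_P0[B] < 1)%E ->
  (exists2 gamma : R, 0 < gamma & ('M_P0 B gamma < +oo)%E) ->
  stationary_mg1 FB lambda (distribution P0 B) -> foreground_background FB ->
  stationary_mg1 Pi lambda (distribution P0 B) -> work_conserving Pi ->
  has_decay_rate (sojourn Pi 0) ->
  has_decay_rate (sojourn FB 0) /\
  (decay_rate (sojourn FB 0) <= decay_rate (sojourn Pi 0))%E.
Proof.
move=> lambda0 B_ge0 B_neq0 stable _ mg1FB fbFB mg1Pi wcPi dPi.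
have nu_ge0 := distribution_ae_ge0 B_ge0.
have nu_gt0 := distribution_gt0 B_ge0 B_neq0.
rewrite -(distribution_mean B_ge0) in stable.
have [theta [m [theta0 mgf tilt]]] := exists_optimal_tilt lambda0 nu_gt0 stable nu_ge0.
set nu : probability R R := distribution P0 B in nu_ge0 mgf tilt mg1FB mg1Pi.
have m1 : 1 <= m.
  rewrite -lee_fin; apply: le_trans mgf.
  have <- : (\int[nu]_x (cst 1%:E x) = 1%:E)%E.
    by rewrite integral_cst// mul1e; exact: probability_setT.
  apply: ae_ge0_le_integral => //.
  - apply/measurable_EFinP; apply: measurableT_comp => //.
  - move: nu_ge0; apply: filterS => x x0 _.
    by rewrite lee_fin -[leLHS]expR0 ler_expR mulr_ge0.
pose delta := theta - lambda * (m - 1).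
have wcFB := foreground_background_work_conserving mg1FB fbFB.
have leFB := work_conserving_log_tail_le lambda0 mg1FB theta0 m1 mgf wcFB.
have lePi := work_conserving_log_tail_le lambda0 mg1Pi theta0 m1 mgf wcPi.
have geFB := fb_log_tail_ge lambda0 mg1FB tilt fbFB.
have cvgFB := log_tail_cvg leFB geFB.
split; first by apply/cvg_ex; exists (- delta)%:E.
have le_lim := lim_log_tail_le dPi lePi.
have le0 : ((- delta)%:E <= 0)%E.
  have neg : \forall x \near +oo, (log_tail (sojourn FB 0) x <= 0)%E.
    by near=> x; apply: log_tail_le0; near: x; exact: nbhs_pinfty_gt.
  exact: (cvge_le neg cvgFB).
(* Both limits are nonpositive, so the absolute values reverse the inequality between them. *)
rewrite /decay_rate (cvg_lim _ cvgFB)//.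
by rewrite !lee0_abs// ?leeN2// (le_trans le_lim).
Unshelve. all: by end_near. Qed.
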